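(* Let $p$ be a prime, let $F$ be a field containing a primitive $p$th root of unity $\rho$, let $\alpha_1,\dots,\alpha_n\in F^\times$, and let $M=(c_{i,j})\in M_n(\mathbb{Z}/p\mathbb{Z})$ be skew-symmetric (with $c_{i,i}=0$ and $c_{j,i}=-c_{i,j}$ for all $i,j$). Let $$C=F[x_1,\dots,x_n : x_k^p=\alpha_k,\ x_i x_j=\rho^{c_{i,j}}x_jx_i \text{ for all } 1\le i,j,k\le n]$$ be the associated Clifford algebra. Then $M$ is similar to a block matrix $$M'=\Big(\bigoplus_{k=1}^m H\Big)\oplus 0_{(n-2m)\times(n-2m)},\qquad H=\begin{pmatrix}0&-1\\1&0\end{pmatrix},$$ for some $m$, and there exists an orthogonal matrix $D=(d_{i,j})\in M_n(\mathbb{Z}/p\mathbb{Z})$ such that $M'=DMD^{t}$. Setting $y_i=x_1^{d_{i,1}}x_2^{d_{i,2}}\cdots x_n^{d_{i,n}}$ for $1\le i\le n$, the set $\{y_1,\dots,y_n\}$ is a $p$-central set generating $C$ whose matrix of commutation exponents is $M'$, and $C$ is isomorphic to $$F[y_1,y_2]\otimes\cdots\otimes F[y_{2m-1},y_{2m}]\otimes F[y_{2m+1},\dots,y_n],$$ where for each $1\le k\le m$, $F[y_{2k-1},y_{2k}]$ is the $p$-cyclic algebra $$(\alpha_1^{d_{2k-1,1}}\cdots\alpha_n^{d_{2k-1,n}},\ \alpha_1^{d_{2k,1}}\cdots\alpha_n^{d_{2k,n}})_{p,F},$$ and $$F[y_{2m+1},\dots,y_n : y_i^p=\alpha_1^{d_{i,1}}\cdots\alpha_n^{d_{i,n}}\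 \text{ for all } 2m+1\le i\le n]$$ is a commutative ring (possibly, but not necessarily, a field). Moreover, $C$ is Azumaya, and each simple homomorphic image of $C$ is of degree $p^m$ and exponent either $p$ or $1$.
   Context: $F[x_1,\dots,x_n:\ldots]$ denotes the associative unital $F$-algebra generated by $x_1,\dots,x_n$ subject to the listed relations, and $F[y_1,y_2]$ etc. denotes the $F$-subalgebra of $C$ generated by the listed elements. A $p$-central set in an associative $F$-algebra is a finite set $\{b_1,\dots,b_n\}$ of invertible elements such that $b_k^p\in F$ for every $k$ and $b_ib_j=\rho^{e_{i,j}}b_jb_i$ for all $i<j$, for some exponents $e_{i,j}$; its matrix of commutation exponents is the skew-symmetric matrix $(e_{i,j})$ over $\mathbb{Z}/p\mathbb{Z}$. The exponents $d_{i,j}$ in the monomials are represented by integers in $\{0,\dots,p-1\}$. For $a,b\in F^\times$, the $p$-cyclic algebra $(a,b)_{p,F}$ is the $F$-algebra $F[x,y: x^p=a,\ y^p=b,\ yx=\rho xy]$. A simple homomorphic image of $C$ is a central simple algebra over its own center $K$; its degree is the square root of its $K$-dimension, and its exponent is the order of its class in the Brauer group of $K$.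
   Formalization: ''Similar'' and ''orthogonal D'' become: an invertible D with M'=DMD^t (orthogonal D can fail: p=5, n=2, c=2); the rest is shown for every such D. For p=2 the scalars y_i^p carry the reordering sign missing in the formula. ''Possibly a field'' is omitted. *)

(* Defs.v *)
From HB Require Import structures.
From mathcomp Require Import all_boot all_order all_algebra.
From mathcomp Require Import boolp.

Set Implicit Arguments.
Unset Strict Implicit.
Unset Printing Implicit Defensive.

Import GRing.Theory.
Local Open Scope ring_scope.

(* [presents Rel x]: the unital associative algebra A, with generators x, is
   the algebra generated by x subject to the relations Rel.  [Rel B y] says
   that the family y in the algebra B satisfies the relations; A is the
   initial such algebra. *)
Definition presents (F : fieldType) (I : Type)
    (Rel : forall B : algType F, (I -> B) -> Prop)
    (A : algType F) (x : I -> A) : Prop :=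
  Rel A x /\
  forall (B : algType F) (y : I -> B), Rel B y ->
    (exists f : {lrmorphism A -> B}, forall i, f (x i) = y i) /\
    (forall f g : {lrmorphism A -> B},
       (forall i, f (x i) = y i) -> (forall i, g (x i) = y i) -> f =1 g).

(* Exponents in Z/p are represented by integers in {0, ..., p-1}: elements of
   'F_p coerce to nat in this way when p is prime. *)
Definition clifford_rel (p n : nat) (F : fieldType) (rho : F)
    (alpha : 'I_n -> F) (M : 'M['F_p]_n) (B : algType F) (x : 'I_n -> B) :=
  (forall k, x k ^+ p = (alpha k)%:A) /\
  (forall i j, x i * x j = rho ^+ (M i j : nat) *: (x j * x i)).

Arguments clifford_rel p {n F} rho alpha M B x.

Definition cyclic_rel (p : nat) (F : fieldType) (rho a b : F)
    (B : algType F) (z : 'I_2 -> B) :=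
  [/\ z 0 ^+ p = a%:A, z 1 ^+ p = b%:A & z 1 * z 0 = rho *: (z 0 * z 1)].

Arguments cyclic_rel p {F} rho a b B z.

Definition commutative_rel (p : nat) (F : fieldType) (I : Type) (a : I -> F)
    (B : algType F) (z : I -> B) :=
  (forall i, z i ^+ p = (a i)%:A) /\ (forall i j, z i * z j = z j * z i).

Arguments commutative_rel p {F I} a B z.

Inductive generated (F : fieldType) (A : algType F) (I : Type) (z : I -> A) :
    A -> Prop :=
| generated_gen i : generated z (z i)
| generated_one : generated z 1
| generated_lin (a : F) u v :
    generated z u -> generated z v -> generated z (a *: u + v)
| generated_mul u v : generated z u -> generated z v -> generated z (u * v).

Section GeneratedSubalgebra.
Variables (F : fieldType) (A : algType F) (I : Type) (z : I -> A).

Definition gen_pred : {pred A} := fun u => `[< generated z u >].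

Fact gen_pred_closed : subalg_closed gen_pred.
Proof.
split; first by apply/asboolP; exact: generated_one.
- by move=> a u v /asboolP hu /asboolP hv; apply/asboolP; exact: generated_lin.
- by move=> u v /asboolP hu /asboolP hv; apply/asboolP; exact: generated_mul.
Qed.

HB.instance Definition _ :=
  GRing.isSubalgClosed.Build F A gen_pred gen_pred_closed.

Record genalg := GenAlg { genalg_val : A; _ : genalg_val \in gen_pred }.

HB.instance Definition _ := [isSub for genalg_val].
HB.instance Definition _ := [Choice of genalg by <:].
HB.instance Definition _ := [SubChoice_isSubAlgebra of genalg by <:].

Fact gen_in i : z i \in gen_pred.
Proof. by apply/asboolP; exact: generated_gen. Qed.

Definition gen_elt (i : I) : genalg := GenAlg (gen_in i).

End GeneratedSubalgebra.

Definition multilinear (R : comNzRingType) (I : eqType) (A : I -> lmodType R)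
    (V : lmodType R) (t : (forall i, A i) -> V) :=
  forall (f : forall i, A i) (i : I) (a : R) (u v : A i),
    t (dfwith f (a *: u + v)) = a *: t (dfwith f u) + t (dfwith f v).

(* [is_tensor_product t]: the algebra T, with t f = \bigotimes_i f i, is the
   tensor product of the algebras A i over F: the underlying space of T is the
   tensor product of the underlying spaces, with componentwise product. *)
Definition is_tensor_product (F : fieldType) (I : finType)
    (A : I -> algType F) (T : algType F) (t : (forall i, A i) -> T) :=
  [/\ @multilinear F I A T t,
      (forall (V : lmodType F) (g : (forall i, A i) -> V),
         @multilinear F I A V g ->
         (exists h : {linear T -> V}, forall f, h (t f) = g f) /\
         (forall h h' : {linear T -> V},
            (forall f, h (t f) = g f) -> (forall f, h' (t f) = g f) ->
            h =1 h')),
      t (fun i => 1) = 1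
    & forall f g, t f * t g = t (fun i => f i * g i)].

Definition skew_symmetric (R : nzRingType) (n : nat) (M : 'M[R]_n) :=
  (forall i, M i i = 0) /\ (forall i j, M j i = - M i j).

(* The block matrix H (+) ... (+) H (+) 0, with m copies of
   H = [0, -1; 1, 0] (rows and columns are numbered from 0). *)
Definition block_H (R : nzRingType) (n m : nat) : 'M[R]_n :=
  \matrix_(i, j)
    if [&& ~~ odd i, (j == i.+1 :> nat) & (i < m.*2)%N] then -1
    else if [&& ~~ odd j, (i == j.+1 :> nat) & (j < m.*2)%N] then 1
    else 0.

Arguments block_H R n m : clear implicits.

(* The p-central set {y_1, ..., y_n} is given as a family, and E is its matrix
   of commutation exponents. *)
Definition p_central (p n : nat) (F : fieldType) (rho : F) (A : algType F)
    (y : 'I_n -> A) (E : 'M['F_p]_n) :=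
  [/\ forall k, exists z, y k * z = 1 /\ z * y k = 1,
      forall k, exists a : F, y k ^+ p = a%:A,
      skew_symmetric E
    & forall i j : 'I_n, (i < j)%N ->
        y i * y j = rho ^+ (E i j : nat) *: (y j * y i)].

Arguments p_central p {n F} rho {A} y E.

Definition monomials (p n : nat) (F : fieldType) (A : algType F)
    (x : 'I_n -> A) (D : 'M['F_p]_n) (i : 'I_n) : A :=
  \prod_(j < n) x j ^+ (D i j : nat).

Arguments monomials p {n F A} x D i.

(* The p-th power of [monomials x D i] in the Clifford algebra.  For odd p it
   is alpha_1^{d_{i,1}} ... alpha_n^{d_{i,n}}; for p = 2 reordering the factors
   of the square contributes a sign, (x_1 x_2)^2 = - x_1^2 x_2^2 when x_1 and
   x_2 anticommute. *)
Definition monomial_power (p n : nat) (F : fieldType) (alpha : 'I_n -> F)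
    (M D : 'M['F_p]_n) (i : 'I_n) : F :=
  (if p == 2%N then
     (-1) ^+ (\sum_(k < n) \sum_(l < n | (k < l)%N) M k l * D i k * D i l)%N
   else 1) *
  \prod_(j < n) alpha j ^+ (D i j : nat).

Arguments monomial_power p {n F} alpha M D i.

Section Factors.
Variables (n m : nat) (hm : (m.*2 <= n)%N).

Fact even_idx_lt (k : 'I_m) : (k.*2 < n)%N.
Proof. by apply: leq_trans hm; rewrite ltn_double. Qed.

Fact odd_idx_lt (k : 'I_m) : (k.*2.+1 < n)%N.
Proof. by apply: leq_trans hm; rewrite -doubleS leq_double. Qed.

Fact tail_idx_lt (j : 'I_(n - m.*2)) : (m.*2 + j < n)%N.
Proof. by rewrite -ltn_subRL. Qed.

(* 0-based: the k-th pair y_{2k-1}, y_{2k} (1 <= k <= m) has indices 2k, 2k+1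
   for 0 <= k < m. *)
Definition even_idx k : 'I_n := Ordinal (even_idx_lt k).
Definition odd_idx k : 'I_n := Ordinal (odd_idx_lt k).
Definition tail_idx j : 'I_n := Ordinal (tail_idx_lt j).

Variables (F : fieldType) (A : algType F) (y : 'I_n -> A).

Definition pair_family (k : 'I_m) (b : 'I_2) : A :=
  if b == 0 then y (even_idx k) else y (odd_idx k).

Definition tail_family (j : 'I_(n - m.*2)) : A := y (tail_idx j).

Definition factor (o : option 'I_m) : algType F :=
  if o is Some k then genalg (pair_family k) else genalg tail_family.

Definition factor_mul (f : forall o, factor o) : A :=
  (\prod_(k < m) genalg_val (f (Some k))) * genalg_val (f None).

End Factors.

Section Center.
Variable A : nzRingType.

Definition center_pred : {pred A} := fun z => `[< forall u, z * u = u * z >].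

Fact center_pred_closed : subring_closed center_pred.
Proof.
split; first by apply/asboolP => u; rewrite mulr1 mul1r.
- move=> z w /asboolP hz /asboolP hw; apply/asboolP => u.
  by rewrite mulrBl mulrBr hz hw.
- move=> z w /asboolP hz /asboolP hw; apply/asboolP => u.
  by rewrite -mulrA hw mulrA hz mulrA.
Qed.

HB.instance Definition _ :=
  GRing.isSubringClosed.Build A center_pred center_pred_closed.

Record center := Center { center_val : A; _ : center_val \in center_pred }.

HB.instance Definition _ := [isSub for center_val].
HB.instance Definition _ := [Choice of center by <:].
HB.instance Definition _ := [SubChoice_isSubNzRing of center by <:].

Fact center_mulC : commutative (@GRing.mul center).
Proof.
case=> z hz w; apply: val_inj.
by move/asboolP: (hz); exact.
Qed.

HB.instance Definition _ :=
  GRing.PzRing_hasCommutativeMul.Build center center_mulC.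

End Center.

Definition over_center (A : nzRingType) : Type := A.

Section OverCenter.
Variable A : nzRingType.

HB.instance Definition _ := GRing.NzRing.on (over_center A).

Definition center_scale (z : center A) (u : over_center A) : over_center A :=
  (center_val z : A) * u.

Fact center_scaleA z w u :
  center_scale z (center_scale w u) = center_scale (z * w) u.
Proof. by rewrite /center_scale mulrA. Qed.

Fact center_scale1 : left_id 1 center_scale.
Proof. by move=> u; rewrite /center_scale mul1r. Qed.

Fact center_scaleDr : right_distributive center_scale +%R.
Proof. by move=> z u v; rewrite /center_scale mulrDr. Qed.

Fact center_scaleDl u : {morph center_scale^~ u : z w / z + w}.
Proof.
by move=> z w; rewrite /center_scale mulrDl.
Qed.

HB.instance Definition _ := GRing.Zmodule_isLmodule.Build (center A)
  (over_center A) center_scaleA center_scale1 center_scaleDr center_scaleDl.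

Fact center_scaleAl (z : center A) (u v : over_center A) :
  z *: (u * v) = z *: u * v.
Proof. exact: mulrA. Qed.

HB.instance Definition _ :=
  GRing.Lmodule_isLalgebra.Build (center A) (over_center A) center_scaleAl.

Fact center_scaleAr (z : center A) (u v : over_center A) :
  z *: (u * v) = u * (z *: v).
Proof.
case: z => z hz; rewrite -[LHS]/(z * (u * v)) -[RHS]/(u * (z * v)).
by move/asboolP: hz => hz; rewrite mulrA hz mulrA.
Qed.

HB.instance Definition _ :=
  GRing.Lalgebra_isAlgebra.Build (center A) (over_center A) center_scaleAr.

End OverCenter.

Definition bilinear_map (R : comNzRingType) (U W V : lmodType R)
    (g : U -> W -> V) :=
  (forall a u u' w, g (a *: u + u') w = a *: g u w + g u' w) /\
  (forall a u w w', g u (a *: w + w') = a *: g u w + g u w').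

(* A is Azumaya over R: it is finitely generated projective (a direct summand
   of some R^k) and faithful over R, and the canonical map
   A (x)_R A^op -> End_R(A), a (x) b |-> (u |-> a u b), is bijective.
   In the last clause, \sum_i a_i (x) b_i = 0 in A (x)_R A^op is spelled out
   as: every R-bilinear map kills \sum_i (a_i, b_i). *)
Definition azumaya (R : comNzRingType) (A : algType R) :=
  [/\ exists (k : nat) (i : {linear A -> 'rV[R]_k})
             (r : {linear 'rV[R]_k -> A}), cancel i r,
      forall c : R, (forall u : A, c *: u = 0) -> c = 0,
      forall phi : {linear A -> A}, exists (s : nat) (a b : 'I_s -> A),
        forall u, phi u = \sum_(i < s) a i * u * b i
    & forall (s : nat) (a b : 'I_s -> A),
        (forall u, \sum_(i < s) a i * u * b i = 0) ->
        forall (V : lmodType R) (g : A -> A -> V), bilinear_map g ->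
        \sum_(i < s) g (a i) (b i) = 0].

Definition two_sided_ideal (A : nzRingType) (J : A -> Prop) :=
  [/\ J 0, forall u v, J u -> J v -> J (u - v)
    & forall a u, J u -> J (a * u) /\ J (u * a)].

Definition simple_ring (A : nzRingType) :=
  forall J : A -> Prop, two_sided_ideal J ->
    (forall u, J u -> u = 0) \/ (forall u, J u).

Definition simple_with_center (K : fieldType) (A : algType K) :=
  simple_ring A /\
  forall z : A, (forall u, z * u = u * z) -> exists c : K, z = c%:A.

Definition has_degree (K : fieldType) (A : algType K) (d : nat) :=
  exists f : {linear A -> 'rV[K]_(d ^ 2)}, bijective f.

(* M_r(A) and M_s(B) are isomorphic as K-algebras for some r, s > 0. *)
Definition brauer_equivalent (K : fieldType) (A B : algType K) :=
  exists (r s : nat) (f : {rmorphism 'M[A]_r.+1 -> 'M[B]_s.+1}),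
    bijective f /\ forall c : K, f (c%:A)%:M = (c%:A)%:M.

(* The e-th power of the class of A in the Brauer group of K is trivial. *)
Definition brauer_power_trivial (K : fieldType) (A : algType K) (e : nat) :=
  exists (T : algType K) (t : (forall i : 'I_e, A) -> T),
    @is_tensor_product K 'I_e (fun=> A) T t /\ brauer_equivalent T K^o.

(* The exponent of A, i.e. the order of its class in the Brauer group. *)
Definition has_exponent (K : fieldType) (A : algType K) (e : nat) :=
  [/\ (0 < e)%N, brauer_power_trivial A e
    & forall e', (0 < e' < e)%N -> ~ brauer_power_trivial A e'].

(* Main.v *)
Require Import Defs.
From HB Require Import structures.
From mathcomp Require Import all_boot all_order all_algebra.
From mathcomp Require Import perm boolp.
From mathcomp Require mxtens.

Import GRing.Theory.
Local Open Scope ring_scope.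

Set Implicit Arguments.
Unset Strict Implicit.
Unset Printing Implicit Defensive.

(** The algebras that occur are all presented by generators z i such that
    z i ^+ p is a scalar and z i * z j is a scalar multiple of z j * z i
    (torus_rel). Such an algebra is spanned by the ordered monomials with
    exponents in Z/p, and multiplication by a generator acts on them by structure
    constants that depend on the relations alone, so it is presented by the
    relations as soon as the monomials are independent (torus_universal).
    Independence always comes from eigenvalues (eigen_independent). In C, the
    automorphisms that multiply one generator by rho exist by the universal
    property and separate the monomials (presents_basis). When the exponents of
    commutation form a nondegenerate matrix, the conjugations by the generators
    separate them (nondegenerate_independent), in every algebra where the
    relations hold.

    The matrix M is brought to the form M' by the usual reduction of alternating
    forms (alternating_normal_form). As D is invertible, the monomials in the y i
    are those in the x i up to order and nonzero scalars (line), so they are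
    again a basis, and so are the monomials in each pair of generators and in the
    commuting tail. This gives the presentations of the factors and, since a
    product of monomials of the factors is a monomial up to a scalar
    (joint_basis), the tensor decomposition (factor_tensor). Averaging the
    conjugations by all monomials projects onto the center, which yields
    coordinates over the center by two-sided multiplications, and these make C
    Azumaya (conj_sum_central, azumaya_of_sandwich).

    In a simple image S the tail becomes scalar, and S is generated over its
    center K by m symplectic pairs with powers a k, c k. Its monomials are
    independent by nondegeneracy, hence its dimension is p ^ (2 m). For the
    exponent, call (a, c) split if such pairs exist in matrices of size at most
    p ^ m (split_by); then S is a matrix algebra (split_isomorphism).
    The p-th tensor power of S is a matrix algebra, by an explicit representation
    of p copies of the pairs by shifts and diagonal matrices (split_copies).
    If the e-th power is split for some 0 < e < p, then e commuting copies of the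
    pairs act on matrices of size p ^ (m * e), and passing to a common eigenspace
    folds them into pairs with powers a k, c k ^ e (split_fold). Folding tensor
    products in the same way shows that the c with (a, c) split are closed under
    products; since p-th powers can be scaled away and e is invertible modulo p,
    (a, c) itself is split (split_coprime), and S has exponent 1. *)

(** * Bases and linear maps *)

Lemma linear_of_fun (R : nzRingType) (V W : lmodType R) (h : V -> W) :
  linear h -> exists h' : {linear V -> W}, h' =1 h.
Proof.
move=> hl; pose m := GRing.isLinear.Build R V W *:%R h hl.
by exists (HB.pack h m : {linear V -> W}).
Qed.

Lemma lrmorphism_of_fun (R : nzRingType) (V W : lalgType R) (h : V -> W) :
  linear h -> h 1 = 1 -> (forall u v, h (u * v) = h u * h v) ->
  exists h' : {lrmorphism V -> W}, h' =1 h.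
Proof.
move=> hl h1 hM; pose m := GRing.isLinear.Build R V W *:%R h hl.
pose m2 := GRing.isMonoidMorphism.Build V W h (conj h1 hM).
by exists (HB.pack h m m2 : {lrmorphism V -> W}).
Qed.

Section Bases.
Variables (F : fieldType) (V : lmodType F) (I : finType).
Implicit Type b : I -> V.

Definition independent b :=
  forall c : I -> F, \sum_i c i *: b i = 0 -> forall i, c i = 0.

Definition spanning b :=
  forall v, exists c : I -> F, v = \sum_i c i *: b i.

Definition is_basis b := independent b /\ spanning b.

Lemma basis_linear_ex b (W : lmodType F) (w : I -> W) :
  is_basis b -> exists h : {linear V -> W}, forall i, h (b i) = w i.
Proof.
case=> ind spa; have [co coE] := choice spa.
have co_uniq c v : v = \sum_i c i *: b i -> forall i, c i = co v i.
  move=> cE i; apply/eqP; rewrite -subr_eq0; apply/eqP.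
  apply: (ind (fun i => c i - co v i)).
  under eq_bigr do rewrite scalerBl.
  by rewrite sumrB -cE -coE subrr.
have [h hE] : exists h : {linear V -> W},
    h =1 (fun v => \sum_i co v i *: w i).
  apply: linear_of_fun => a u v; rewrite scaler_sumr -big_split /=.
  apply: eq_bigr => i _; rewrite scalerA -scalerDl; congr (_ *: _).
  symmetry; apply: (co_uniq (fun i => a * co u i + co v i)).
  rewrite {1}(coE u) {1}(coE v) scaler_sumr -big_split /=.
  by apply: eq_bigr => j _; rewrite scalerDl scalerA.
have delta i j : (j == i)%:R = co (b i) j.
  apply: (co_uniq (fun j => (j == i)%:R)).
  rewrite (bigD1 i) //= eqxx scale1r big1 ?addr0 // => k /negPf->.
  by rewrite scale0r.
exists h => i; rewrite hE (bigD1 i) //= big1 => [|j ji].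
  by rewrite -delta ?eqxx ?scale1r ?addr0.
by rewrite -delta (negPf ji) scale0r.
Qed.

Lemma eq_linear_spanning b (W : lmodType F) (h h' : {linear V -> W}) :
  spanning b -> (forall i, h (b i) = h' (b i)) -> h =1 h'.
Proof.
move=> spa hh' v; have [c ->] := spa v; rewrite !linear_sum.
by apply: eq_bigr => i _; rewrite !linearZ /= hh'.
Qed.

(** Joint eigenvectors whose eigenvalues separate them are independent: the
    operator s j minus the eigenvalue of one of them kills it and rescales the
    others, so a relation with the fewest terms has at most one. *)
Lemma eigen_independent b (J : Type) (s : J -> {linear V -> V})
    (lam : J -> I -> F) :
  (forall j i, s j (b i) = lam j i *: b i) -> (forall i, b i != 0) ->
  (forall i i', i != i' -> exists j, lam j i != lam j i') ->
  independent b.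
Proof.
move=> sb b0 sep c; move: {2}_.+1 (ltnSn #|[pred i | c i != 0]|) => k.
elim: k c => // k IH c ck c0 i; apply/eqP/negPn/negP => ci.
have [i' /= /andP[ci' i'i] | cz] := pickP [pred i' | (c i' != 0) && (i' != i)].
  have [j lj] := sep _ _ i'i.
  pose d i1 := (lam j i1 - lam j i) * c i1.
  have : d i' = 0.
    apply: IH.
      rewrite -ltnS; apply: leq_trans ck; rewrite ltnS; apply: proper_card.
      apply/properP; split.
        apply/subsetP => i1; rewrite !inE /d; apply: contra => /eqP->.
        by rewrite mulr0.
      by exists i; rewrite ?inE // /d subrr mul0r eqxx.
    have := congr1 (s j) c0; rewrite linear0 linear_sum => sc.
    rewrite (_ : \sum_i _ = \sum_i s j (c i *: b i) -
              lam j i *: \sum_i c i *: b i).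
      by rewrite sc c0 scaler0 subrr.
    rewrite scaler_sumr -sumrB; apply: eq_bigr => i1 _.
    by rewrite linearZ /= sb /d mulrBl scalerBl !scalerA [c _ * _]mulrC.
  by move/eqP; rewrite mulf_eq0 (negPf ci') subr_eq0 (negPf lj).
move/eqP: c0; rewrite (bigD1 i) //= big1 ?addr0.
  by rewrite scaler_eq0 (negPf ci) (negPf (b0 i)).
move=> i' i'i; have /= := cz i'; rewrite i'i andbT => /negbFE/eqP->.
by rewrite scale0r.
Qed.

End Bases.

Lemma dim_mx (K : fieldType) N : \dim (fullv : {vspace 'M[K]_N}) = (N * N)%N.
Proof. by rewrite dimvf. Qed.

Section MatrixBases.
Variables (K : fieldType) (N : nat) (I : finType) (b : I -> 'M[K]_N).

Let X : #|I|.-tuple 'M[K]_N := [tuple b (enum_val i) | i < #|I|].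

Lemma sum_enum_tuple (c : I -> K) :
  \sum_i c i *: b i = \sum_(i < #|I|) c (enum_val i) *: X`_i.
Proof.
rewrite (reindex_onto enum_val enum_rank) /=; last by move=> i _; rewrite enum_rankK.
apply: eq_big => i; first by rewrite enum_valK eqxx.
by move=> _; rewrite nth_mktuple.
Qed.

Lemma independent_free : independent b -> free X.
Proof.
move=> ind; apply/freeP => k k0 i; pose c j := k (enum_rank j).
suff /(ind c)/(_ (enum_val i)) : \sum_i c i *: b i = 0 by rewrite /c enum_valK.
rewrite sum_enum_tuple -[RHS]k0; by apply: eq_bigr => j _; rewrite /c enum_valK.
Qed.

Lemma spanning_mxP : spanning b <-> (fullv <= <<X>>)%VS.
Proof.
split=> [spa | full v].
  apply/subvP => v _; have [c ->] := spa v; rewrite sum_enum_tuple.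
  apply: rpred_sum => i _; apply/rpredZ/memv_span.
  by apply: mem_nth; rewrite size_tuple.
have /coord_span vE : v \in <<X>>%VS by apply: (subvP full); rewrite memvf.
exists (fun i => coord X (enum_rank i) v); rewrite sum_enum_tuple {1}vE.
by apply: eq_bigr => i _; rewrite enum_valK.
Qed.

Lemma spanning_card_mx : spanning b -> (N * N <= #|I|)%N.
Proof.
move/spanning_mxP/dimvS; rewrite dim_mx => /leq_trans; apply.
by apply: leq_trans (dim_span _) _; rewrite size_tuple.
Qed.

Lemma independent_spanning_mx :
  independent b -> (N * N <= #|I|)%N -> spanning b.
Proof.
move=> /independent_free /eqP; rewrite size_tuple -(dim_mx K) => dimX leNI.
apply/spanning_mxP; suff /eqP-> : <<X>>%VS == fullv by [].
by rewrite eqEdim subvf dimX.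
Qed.

End MatrixBases.

(** * Algebras with scalar-commuting generators *)

Section ScalarCommutation.
Variables (F : fieldType) (A : algType F).
Implicit Types (c : F) (a b : A).

Lemma scomm_exprr c a b k :
  a * b = c *: (b * a) -> a * b ^+ k = c ^+ k *: (b ^+ k * a).
Proof.
move=> ab; elim: k => [|k IH]; first by rewrite !expr0 scale1r mulr1 mul1r.
rewrite (exprS b) mulrA ab -scalerAl -(mulrA _ a) IH -scalerAr.
by rewrite scalerA -(exprS c) mulrA.
Qed.

Lemma scomm_exprl c a b k :
  a * b = c *: (b * a) -> a ^+ k * b = c ^+ k *: (b * a ^+ k).
Proof.
move=> ab; elim: k => [|k IH]; first by rewrite !expr0 scale1r mulr1 mul1r.
rewrite (exprS a) -(mulrA a _ b) IH -scalerAr (mulrA a) ab -scalerAl scalerA.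
by rewrite -exprSr mulrA.
Qed.

Lemma scommMl c c' a a' b :
  a * b = c *: (b * a) -> a' * b = c' *: (b * a') ->
  a * a' * b = (c * c') *: (b * (a * a')).
Proof.
move=> ab a'b; rewrite -(mulrA a) a'b -scalerAr (mulrA a) ab -scalerAl scalerA.
by rewrite mulrA mulrC.
Qed.

Lemma scommMr c c' a b b' :
  a * b = c *: (b * a) -> a * b' = c' *: (b' * a) ->
  a * (b * b') = (c * c') *: (b * b' * a).
Proof.
by move=> ab ab'; rewrite mulrA ab -scalerAl -(mulrA b a) ab' -scalerAr scalerA mulrA.
Qed.

Lemma scommZ c d e a b :
  a * b = c *: (b * a) -> (d *: a) * (e *: b) = c *: ((e *: b) * (d *: a)).
Proof.
move=> ab; rewrite -!scalerAl -!scalerAr ab !scalerA; congr (_ *: _).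
by rewrite mulrC [d * e]mulrC mulrA.
Qed.

Lemma scomm_prodr (J : Type) (s : seq J) a (f : J -> A) (c : J -> F) :
  (forall j, a * f j = c j *: (f j * a)) ->
  a * \prod_(j <- s) f j = \prod_(j <- s) c j *: (\prod_(j <- s) f j * a).
Proof.
move=> af; elim: s => [|j s IH]; first by rewrite !big_nil scale1r mulr1 mul1r.
by rewrite !big_cons mulrA af -scalerAl -(mulrA _ a) IH -scalerAr scalerA mulrA.
Qed.

Lemma scomm_prodl (J : Type) (s : seq J) b (f : J -> A) (c : J -> F) :
  (forall j, f j * b = c j *: (b * f j)) ->
  (\prod_(j <- s) f j) * b = \prod_(j <- s) c j *: (b * \prod_(j <- s) f j).
Proof.
move=> fb; elim: s => [|j s IH]; first by rewrite !big_nil scale1r mulr1 mul1r.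
rewrite !big_cons -mulrA IH -scalerAr (mulrA (f j)) fb -scalerAl scalerA mulrC.
by rewrite mulrA.
Qed.

(** Moving all a to the left costs one factor c for each pair. *)
Lemma expr_mul_scomm c a b k :
  b * a = c *: (a * b) -> (a * b) ^+ k = c ^+ 'C(k, 2) *: (a ^+ k * b ^+ k).
Proof.
move=> ba; elim: k => [|k IH]; first by rewrite !expr0 scale1r mulr1.
rewrite (exprSr (a * b)) IH binS bin1 exprD -scalerA -scalerAl; congr (_ *: _).
rewrite !exprSr -!mulrA (mulrA (b ^+ k)) (scomm_exprl _ ba) -!scalerAl -scalerAr.
by rewrite !mulrA.
Qed.

End ScalarCommutation.

Section Torus.
Variables (p : nat) (F : fieldType) (I : finType).
Variables (al : I -> F) (q : I -> I -> F).

(** Clifford algebras, cyclic algebras and their commutative analogues are all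
    given by relations of this shape, over different index types. *)
Definition torus_rel (A : algType F) (z : I -> A) :=
  (forall i, z i ^+ p = (al i)%:A) /\
  (forall i j, z i * z j = q i j *: (z j * z i)).

Definition mono (A : algType F) (z : I -> A) (v : {ffun I -> 'F_p}) : A :=
  \prod_i z i ^+ (v i : nat).

Definition unit_exp (i : I) : {ffun I -> 'F_p} := [ffun j => (j == i)%:R].

(** The scalar by which conjugation by the generator i multiplies the monomial
    of exponent v. *)
Definition chi (i : I) (v : {ffun I -> 'F_p}) : F := \prod_j q i j ^+ (v j : nat).

Definition nondegenerate :=
  forall u v : {ffun I -> 'F_p}, u != v -> exists i, chi i u != chi i v.

(** The structure constant for multiplying the monomial of exponent v, with
    factors ordered along s, by the generator i on the left: the generator
    passes the factors before its own, where a full p-th power may arise. *)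
Fixpoint mul_coef (s : seq I) (i : I) (v : {ffun I -> 'F_p}) : F :=
  if s is j :: s' then
    if j == i then al i ^+ ((v i).+1 %/ p)
    else q i j ^+ (v j : nat) * mul_coef s' i v
  else 1.

Hypothesis p_pr : prime p.

Lemma val_Fp_add (a b : 'F_p) : (a + b)%R = ((a + b) %% p)%N :> nat.
Proof. by rewrite /=; congr (_ %% _)%N; apply: Fp_cast. Qed.

Lemma val_Fp_succ (a : 'F_p) : (a + 1)%R = (a.+1 %% p)%N :> nat.
Proof. by rewrite val_Fp_add addn1. Qed.

Lemma val_Fp_mul (a b : 'F_p) : (a * b)%R = ((a * b) %% p)%N :> nat.
Proof. by rewrite /=; congr (_ %% _)%N; apply: Fp_cast. Qed.

Lemma ltn_Fp (a : 'F_p) : (a < p)%N.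
Proof. by rewrite -[X in (_ < X)%N](Fp_cast p_pr). Qed.

Lemma sum_unit_exp (u : {ffun I -> 'F_p}) : \sum_j unit_exp j *+ u j = u.
Proof.
apply/ffunP => i; rewrite sum_ffunE (bigD1 i) //= ffunMnE ffunE eqxx natr_Zp.
by rewrite big1 ?addr0 // => j ji; rewrite ffunMnE ffunE eq_sym (negPf ji) mul0rn.
Qed.

Section Relations.
Variables (A : algType F) (z : I -> A).
Hypothesis zP : torus_rel z.

Lemma mono0 : mono z 0 = 1.
Proof. by rewrite /mono big1 // => i _; rewrite ffunE expr0. Qed.

Lemma gen_mul_prod s i (v : {ffun I -> 'F_p}) : uniq s -> i \in s ->
  z i * \prod_(j <- s) z j ^+ (v j : nat) =
  mul_coef s i v *: \prod_(j <- s) z j ^+ ((v + unit_exp i)%R j : nat).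
Proof.
elim: s => //= j s IH /andP[js us]; rewrite inE !big_cons.
case: (eqVneq j i) => [<- _|ji /= is_].
  rewrite mulrA -exprS {1}(divn_eq (v j).+1 p) exprD mulnC exprM zP.1 exprZn.
  rewrite expr1n -!scalerAl mul1r !ffunE eqxx val_Fp_succ; congr (_ *: (_ * _)).
  apply: eq_big_seq => k ks; rewrite !ffunE; case: eqP => [kj|_]; last by rewrite addr0.
  by rewrite kj (negPf js) in ks.
rewrite mulrA (scomm_exprr _ (zP.2 i j)) -scalerAl -(mulrA _ (z i)) IH //.
rewrite -scalerAr scalerA !ffunE; case: eqP => [ij|_]; last by rewrite addr0.
by rewrite ij eqxx in ji.
Qed.

(** The structure constants do not depend on the algebra. *)
Lemma gen_mul_mono i v :
  z i * mono z v = mul_coef (index_enum I) i v *: mono z (v + unit_exp i).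
Proof. by apply: gen_mul_prod; rewrite ?index_enum_uniq ?mem_index_enum. Qed.

Lemma gen_mono_comm i v : z i * mono z v = chi i v *: (mono z v * z i).
Proof.
by apply: scomm_prodr => j; apply/scomm_exprr/zP.2.
Qed.

(** The span of the monomials is stable under left multiplication by the
    generators, hence by everything. *)
Lemma mono_spanning : (forall a, generated z a) -> spanning (mono z).
Proof.
move=> gen.
pose spans (a : A) := exists c : {ffun I -> 'F_p} -> F, a = \sum_v c v *: mono z v.
have spans_lin a u v : spans u -> spans v -> spans (a *: u + v).
  case=> c -> [d ->]; exists (fun w => a * c w + d w).
  rewrite scaler_sumr -big_split; apply: eq_bigr => w _.
  by rewrite scalerA scalerDl.
have spans_mono v : spans (mono z v).
  exists (fun w => (w == v)%:R); rewrite (bigD1 v) //= eqxx scale1r big1 ?addr0 //.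
  by move=> w /negPf->; rewrite scale0r.
have spans0 : spans 0.
  by exists (fun=> 0); rewrite big1 // => v _; rewrite scale0r.
suff P a : forall v, spans (a * mono z v).
  by move=> a; have := P a 0; rewrite mono0 mulr1.
elim: (gen a) => [i|| c u w _ IHu _ IHw | u w _ IHu _ IHw] v.
- rewrite gen_mul_mono -[X in spans X]addr0; exact: spans_lin.
- by rewrite mul1r.
- by rewrite mulrDl -scalerAl; apply: spans_lin.
rewrite -mulrA; have [c ->] := IHw v; rewrite mulr_sumr.
elim/big_ind: _ => // [x y|x _]; first by have := spans_lin 1 x y; rewrite scale1r.
by rewrite -scalerAr -[X in spans X]addr0; apply: spans_lin.
Qed.

Hypothesis (al0 : forall i, al i != 0) (q0 : forall i j, q i j != 0).

Lemma mul_coef_neq0 s i v : mul_coef s i v != 0.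
Proof.
elim: s => [|j s IH] /=; first exact: oner_neq0.
by case: (j == i); [apply: expf_neq0 | rewrite mulf_neq0 ?expf_neq0].
Qed.

(** Products, powers and inverses of monomials are again monomials up to a
    nonzero scalar; recording only the exponent avoids tracking the scalars. *)
Definition line (v : {ffun I -> 'F_p}) (a : A) :=
  exists2 c : F, c != 0 & a = c *: mono z v.

Lemma line_mono v : line v (mono z v).
Proof. by exists 1; rewrite ?oner_neq0 ?scale1r. Qed.

Lemma line_scale v c a : c != 0 -> line v a -> line v (c *: a).
Proof. by move=> c0 [d d0 ->]; exists (c * d); rewrite ?mulf_neq0 ?scalerA. Qed.

Lemma line_gen_mul i v a : line v a -> line (v + unit_exp i) (z i * a).
Proof.
case=> c c0 ->; exists (c * mul_coef (index_enum I) i v).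
  by rewrite mulf_neq0 ?mul_coef_neq0.
by rewrite -scalerAr gen_mul_mono scalerA.
Qed.

Lemma line_mul u v a b : line u a -> line v b -> line (u + v) (a * b).
Proof.
case=> c c0 -> lb; rewrite -scalerAl; apply: line_scale => //.
rewrite -{1}(sum_unit_exp u) /mono; elim/big_rec2: _ => [|i w x _ IH].
  by rewrite add0r mul1r.
rewrite -mulrA; move: (u i : nat) => k; elim: k => [|k IHk].
  by rewrite mulr0n add0r expr0 mul1r.
rewrite exprS -mulrA mulrS -!addrA (addrC (unit_exp i)) !addrA.
exact: line_gen_mul.
Qed.

Lemma line1 : line 0 1.
Proof. by rewrite -mono0; apply: line_mono. Qed.

Lemma line_gen i : line (unit_exp i) (z i).
Proof. by have := line_gen_mul i line1; rewrite add0r mulr1. Qed.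

Lemma line_expr v a k : line v a -> line (v *+ k) (a ^+ k).
Proof.
move=> la; elim: k => [|k IH]; first by rewrite expr0; apply: line1.
by rewrite exprS mulrS; apply: line_mul.
Qed.

Lemma line_prod (J : Type) (s : seq J) (v : J -> {ffun I -> 'F_p}) (a : J -> A) :
  (forall j, line (v j) (a j)) -> line (\sum_(j <- s) v j) (\prod_(j <- s) a j).
Proof.
move=> la; elim/big_rec2: _ => [|j w b _ IH]; first exact: line1.
exact: line_mul.
Qed.

Lemma line_unit v a : line v a -> exists b, [/\ line (- v) b, b * a = 1 & a * b = 1].
Proof.
move=> la; have lm := line_mono (- v).
have [c c0 ab] : line 0 (a * mono z (- v)) by rewrite -(subrr v); apply: line_mul.
have [d d0 ba] : line 0 (mono z (- v) * a) by rewrite -(addNr v); apply: line_mul.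
rewrite mono0 in ab ba.
have ab1 : a * (c^-1 *: mono z (- v)) = 1.
  by rewrite -scalerAr ab scalerA mulVf // scale1r.
have ba1 : (d^-1 *: mono z (- v)) * a = 1.
  by rewrite -scalerAl ba scalerA mulVf // scale1r.
exists (c^-1 *: mono z (- v)); split=> //; first by apply: line_scale; rewrite ?invr_eq0.
by rewrite -[c^-1 *: _]mul1r -ba1 -mulrA ab1 mulr1.
Qed.

Lemma line_neq0 v a : line v a -> a != 0.
Proof.
move=> /line_unit[b [_ ba _]]; apply: contra_eq_neq ba => ->.
by rewrite mulr0 eq_sym oner_neq0.
Qed.

Lemma gen_unit i : exists b, b * z i = 1 /\ z i * b = 1.
Proof. by have [b [_ ? ?]] := line_unit (line_gen i); exists b. Qed.

(** The monomials are joint eigenvectors of the conjugations by generators, and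
    nondegeneracy says that the eigenvalues chi separate them. *)
Lemma nondegenerate_independent : nondegenerate -> independent (mono z).
Proof.
move=> ndg; have [zi ziP] := choice gen_unit.
have sP i : exists s : {linear A -> A}, s =1 (fun u => z i * u * zi i).
  by apply: linear_of_fun => a u v; rewrite mulrDr mulrDl -scalerAr -scalerAl.
have [s sE] := choice sP.
apply: (@eigen_independent _ _ _ (mono z) I s chi) => // [i v|v].
  by rewrite sE gen_mono_comm -scalerAl -mulrA (ziP i).2 mulr1.
exact: line_neq0 (line_mono v).
Qed.

End Relations.

(** The linear map that matches monomials commutes with left multiplication by
    generators, hence is multiplicative. *)
Lemma torus_universal (A B : algType F) (z : I -> A) (w : I -> B) :
  torus_rel z -> torus_rel w -> (forall a, generated z a) -> is_basis (mono z) ->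
  exists f : {lrmorphism A -> B}, forall i, f (z i) = w i.
Proof.
move=> zP wP gen [ind spa].
have [f fm] := basis_linear_ex (mono w) (conj ind spa).
have f1 : f 1 = 1 by rewrite -(mono0 z) fm mono0.
have fz i a : f (z i * a) = w i * f a.
  have [c ->] := spa a; rewrite mulr_sumr !linear_sum mulr_sumr.
  apply: eq_bigr => v _; rewrite -scalerAr !linearZ /= fm gen_mul_mono //.
  by rewrite -scalerAr gen_mul_mono // linearZ /= fm.
have fM a : forall b, f (a * b) = f a * f b.
  elim: (gen a) => [i|| c u v _ IHu _ IHv | u v _ IHu _ IHv] b.
  - by rewrite fz -[in f (z i)](mulr1 (z i)) fz f1 mulr1.
  - by rewrite mul1r f1 mul1r.
  - by rewrite mulrDl -scalerAl !linearP /= IHu IHv mulrDl scalerAl.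
  by rewrite -mulrA IHu IHv mulrA -IHu.
have [h hE] := lrmorphism_of_fun (linearP f) f1 fM.
by exists h => i; rewrite hE -[z i]mulr1 fz f1 mulr1.
Qed.


End Torus.

Arguments mono {p F I A} z v.
Arguments unit_exp {p I} i.
Arguments line {p F I A} z v a.

(** * Generated subalgebras and presentations *)

Lemma generated_lrmorphism_eq (F : fieldType) (A B : algType F) (I : Type)
    (z : I -> A) (f g : {lrmorphism A -> B}) :
  (forall i, f (z i) = g (z i)) -> forall a, generated z a -> f a = g a.
Proof.
move=> fg a; elim=> [i|| c u v _ IHu _ IHv | u v _ IHu _ IHv].
- exact: fg.
- by rewrite !rmorph1.
- by rewrite !linearP /= IHu IHv.
by rewrite !rmorphM /= IHu IHv.
Qed.

Lemma generated_comm (F : fieldType) (A : algType F) (I J : Type)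
    (z : I -> A) (w : J -> A) :
  (forall i j, z i * w j = w j * z i) ->
  forall a b, generated z a -> generated w b -> a * b = b * a.
Proof.
move=> zw a b ga gb; have zb i : z i * b = b * z i.
  elim: gb => [j|| c u v _ IHu _ IHv | u v _ IHu _ IHv].
  - exact: zw.
  - by rewrite mul1r mulr1.
  - by rewrite mulrDr mulrDl -scalerAl -scalerAr IHu IHv.
  by rewrite mulrA IHu -mulrA IHv mulrA.
elim: ga => [i|| c u v _ IHu _ IHv | u v _ IHu _ IHv].
- exact: zb.
- by rewrite mul1r mulr1.
- by rewrite mulrDr mulrDl -scalerAl -scalerAr IHu IHv.
by rewrite -mulrA IHv mulrA IHu mulrA.
Qed.

Section GenElt.
Variables (F : fieldType) (A : algType F) (I : Type) (z : I -> A).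

Lemma gen_elt_generated (u : genalg z) : generated (gen_elt z) u.
Proof.
case: u => c hc; have gc : generated z c by apply/asboolP.
move: hc; elim: gc => {c} [i h||c u v gu IHu gv IHv h|u v gu IHu gv IHv h].
- have -> : GenAlg h = gen_elt z i by apply: val_inj.
  exact: generated_gen.
- move=> h; have -> : GenAlg h = 1 by apply: val_inj.
  exact: generated_one.
- have hu : u \in gen_pred z by apply/asboolP.
  have hv : v \in gen_pred z by apply/asboolP.
  have -> : GenAlg h = c *: GenAlg hu + GenAlg hv by apply: val_inj.
  exact: generated_lin.
have hu : u \in gen_pred z by apply/asboolP.
have hv : v \in gen_pred z by apply/asboolP.
have -> : GenAlg h = GenAlg hu * GenAlg hv by apply: val_inj.
exact: generated_mul.
Qed.

Lemma genalg_val_lrmorphism :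
  exists f : {lrmorphism genalg z -> A}, f =1 @genalg_val F A I z.
Proof. exact: lrmorphism_of_fun. Qed.

Lemma genalg_valP (u : genalg z) : generated z (genalg_val u).
Proof. by case: u => c hc; apply/asboolP. Qed.

(** The subalgebra generated by the generators satisfies the universal
    property too, so that its inclusion is onto. *)
Lemma presents_generated (Rel : forall B : algType F, (I -> B) -> Prop) :
  presents Rel z -> Rel (genalg z) (gen_elt z) -> forall a, generated z a.
Proof.
case=> [Rz univ] Rg a; have [[f fE] _] := univ _ _ Rg.
have [i iE] := genalg_val_lrmorphism.
have [_ uniq] := univ _ _ Rz.
have <- : i (f a) = a.
  rewrite -[i (f a)]/((i \o f) a) -[RHS]/((idfun : {lrmorphism A -> A}) a).
  by apply: uniq => j //=; rewrite fE iE.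
by rewrite iE; apply: genalg_valP.
Qed.

End GenElt.

(** * Tensor products of algebras *)

Section Multilinear.
Variables (F : fieldType) (I : finType) (A : I -> algType F) (B : I -> finType).
Variables (b : forall o, B o -> A o).
Arguments b : clear implicits.

Lemma dfwith_same (f : forall o, A o) o : dfwith f (f o) = f.
Proof. by apply: functional_extensionality_dep => o'; case: dfwithP. Qed.

Lemma multilinear_dfwith (V : lmodType F) (g : (forall o, A o) -> V) f o :
  @multilinear F I A V g ->
  exists h : {linear A o -> V}, h =1 (fun u : A o => g (dfwith f u)).
Proof. by move=> gl; apply: linear_of_fun => a u v; apply: gl. Qed.

(** Replacing the arguments by basis vectors one index at a time. *)
Lemma multilinear_eq (V : lmodType F) (g g' : (forall o, A o) -> V) :
  (forall o, spanning (b o)) ->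
  @multilinear F I A V g -> @multilinear F I A V g' ->
  (forall beta : forall o, B o,
     g (fun o => b o (beta o)) = g' (fun o => b o (beta o))) ->
  forall f, g f = g' f.
Proof.
move=> spa gl gl' gg'.
suff P (s : seq I) f : (forall o, o \notin s -> exists j, f o = b o j) -> g f = g' f.
  by move=> f; apply: (P (enum I)) => o; rewrite mem_enum.
elim: s f => [|o s IH] f fb.
  pose beta o := projT1 (cid (fb o isT)).
  have -> : f = fun o => b o (beta o).
    by apply: functional_extensionality_dep => o; rewrite /beta; case: cid.
  exact: gg'.
have [h hE] := multilinear_dfwith f o gl; have [h' hE'] := multilinear_dfwith f o gl'.
rewrite -(dfwith_same f o) -hE -hE'; apply: (eq_linear_spanning (spa o)) => j.
rewrite hE hE'; apply: IH => o' o's.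
case: (eqVneq o o') o's => [<- _|oo' o's]; first by exists j; rewrite dfwith_in.
by rewrite dfwith_out //; apply: fb; rewrite inE eq_sym negb_or oo'.
Qed.

Lemma tensor_of_basis (T : algType F) (t : (forall o, A o) -> T) :
  (forall o, spanning (b o)) -> @multilinear F I A T t ->
  is_basis (fun beta : {dffun forall o, B o} => t (fun o => b o (beta o))) ->
  t (fun=> 1) = 1 -> (forall f g, t f * t g = t (fun o => f o * g o)) ->
  is_tensor_product t.
Proof.
move=> spa tl bas t1 tM; split=> // V g gl.
have bE (beta : forall o, B o) :
    (fun o => b o ((finfun beta : {dffun forall o, B o}) o)) = fun o => b o (beta o).
  by apply: functional_extensionality_dep => o; rewrite ffunE.
split.
  have [h hE] := basis_linear_ex (fun beta : {dffun forall o, B o} => g (fun o => b o (beta o))) bas.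
  exists h => f; apply: (multilinear_eq (g := h \o t) spa) => //.
    by move=> f' o a u v /=; rewrite tl linearP.
  by move=> beta /=; rewrite -bE hE.
move=> h h' hg hg'; apply: (eq_linear_spanning bas.2) => beta.
by rewrite hg hg'.
Qed.

(** Expanding along the bases is a multilinear map to a space of the expected
    dimension; followed by summation it is the identity on pure tensors, hence
    everywhere. *)
Lemma tensor_spanning (T : algType F) (t : (forall o, A o) -> T) :
  (forall o, is_basis (b o)) -> is_tensor_product t ->
  spanning (fun beta : {dffun forall o, B o} => t (fun o => b o (beta o))).
Proof.
move=> bas [tl univ _ _].
have cP o : exists c : {linear A o -> {ffun B o -> F^o}},
    forall j, c (b o j) = [ffun k => (k == j)%:R].
  by have [c cE] := basis_linear_ex (fun j => [ffun k => (k == j)%:R] : {ffun B o -> F^o}) (bas o); exists c.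
pose c o := projT1 (cid (cP o)).
have cE o j k : c o (b o j) k = (k == j)%:R.
  by rewrite /c; case: cid => /= c' ->; rewrite ffunE.
pose V := {ffun {dffun forall o, B o} -> F^o}.
pose g f : V := [ffun beta : {dffun forall o, B o} => \prod_o c o (f o) (beta o) : F^o].
have gl : @multilinear F I A V g.
  move=> f o a u v; apply/ffunP => beta; rewrite !ffunE.
  have E w : \prod_o' c o' (dfwith f w o') (beta o') =
      c o w (beta o) * \prod_(o' | o' != o) c o' (f o') (beta o').
    rewrite (bigD1 o) //= dfwith_in; congr (_ * _); apply: eq_bigr => o' o'o.
    by rewrite dfwith_out // eq_sym.
  by rewrite !E linearP !ffunE mulrDl scalerAl.
have [[h hE] _] := univ V g gl.
have [k kE] : exists k : {linear V -> T},
    k =1 (fun x => \sum_(beta : {dffun forall o, B o}) x beta *: t (fun o => b o (beta o))).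
  apply: linear_of_fun => a u v; rewrite scaler_sumr -big_split /=.
  by apply: eq_bigr => beta _; rewrite !ffunE scalerDl scalerA.
have kh f : k (h (t f)) = t f.
  move: f; apply: (multilinear_eq (g := k \o (h \o t)) (fun o => (bas o).2)) => //.
    by move=> f' o a u v /=; rewrite tl !linearP.
  move=> beta /=; rewrite hE kE (bigD1 (finfun beta : {dffun forall o, B o})) //=.
  rewrite ffunE big1 => [|o _]; last by rewrite cE ffunE eqxx.
  rewrite scale1r big1 ?addr0 => [|beta' ne].
    by congr t; apply: functional_extensionality_dep => o; rewrite ffunE.
  rewrite ffunE; have [o ho] : exists o, beta' o != beta o.
    apply/existsP; apply: contraNT ne; rewrite negb_exists => /forallP E.
    by apply/eqP/ffunP => o; rewrite ffunE; apply/eqP; have := E o; rewrite negbK.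
  by rewrite (bigD1 o) //= cE (negPf ho) mul0r scale0r.
have [_ uniq] := univ T t tl.
move=> v; exists (fun beta => h v beta); rewrite -kE.
by apply: esym; apply: (uniq (k \o h) idfun).
Qed.

End Multilinear.

Section OrderedProducts.
Variables (R : pzRingType) (I : eqType).

(** In an ordered product the dependence on one factor is two-sided
    multiplication by the product of the others; this gives multilinearity
    without commutativity. *)
Lemma prod_factor_context (s : seq I) (G : I -> R) (o : I) :
  uniq s -> o \in s -> exists P Q, forall G' : I -> R,
    (forall o', o' != o -> G' o' = G o') -> \prod_(i <- s) G' i = P * G' o * Q.
Proof.
elim: s => //= i s IH /andP[is_ us]; rewrite inE; case: (eqVneq o i) => [-> _|oi /= os].
  exists 1, (\prod_(j <- s) G j) => G' GG'; rewrite big_cons mul1r; congr (_ * _).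
  by apply: eq_big_seq => j js; apply: GG'; apply: contraNneq is_ => <-.
have [P [Q PQ]] := IH us os; exists (G i * P), Q => G' GG'.
by rewrite big_cons (PQ _ GG') GG' 1?eq_sym // !mulrA.
Qed.

Lemma prod_mul_comm (s : seq I) (G H : I -> R) :
  uniq s -> (forall i j, i != j -> G i * H j = H j * G i) ->
  \prod_(i <- s) (G i * H i) = (\prod_(i <- s) G i) * \prod_(i <- s) H i.
Proof.
move=> us GH; elim: s us => [_|i s IH /= /andP[is_ us]]; first by rewrite !big_nil mulr1.
rewrite !big_cons IH // -!mulrA; congr (_ * _); rewrite !mulrA; congr (_ * _).
rewrite big_seq; apply: commr_prod => j js; rewrite /GRing.comm GH //.
by apply: contraNneq is_ => <-.
Qed.

End OrderedProducts.

Section CommutingMorphisms.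
Variables (F : fieldType) (I : finType) (A : I -> algType F) (T : algType F).
Variable phi : forall o, {lrmorphism A o -> T}.
Hypothesis phi_comm :
  forall o o' u v, o != o' -> phi o u * phi o' v = phi o' v * phi o u.

Definition prod_morph (f : forall o, A o) : T := \prod_o phi o (f o).

Lemma prod_morph_multilinear : @multilinear F I A T prod_morph.
Proof.
move=> f o a u v; rewrite /prod_morph.
have [P [Q PQ]] := prod_factor_context (fun o' => phi o' (f o'))
  (index_enum_uniq I) (mem_index_enum o).
have E w : \prod_o' phi o' (dfwith f w o') = P * phi o w * Q.
  rewrite (PQ (fun o' => phi o' (dfwith f w o'))) ?dfwith_in // => o' o'o.
  by rewrite dfwith_out // eq_sym.
by rewrite !E linearP mulrDr mulrDl -scalerAr -scalerAl.
Qed.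

Lemma prod_morph1 : prod_morph (fun=> 1) = 1.
Proof. by rewrite /prod_morph big1 // => o _; rewrite rmorph1. Qed.

Lemma prod_morphM f g :
  prod_morph f * prod_morph g = prod_morph (fun o => f o * g o).
Proof.
rewrite /prod_morph -prod_mul_comm ?index_enum_uniq // => [|i j ij].
  by apply: eq_bigr => o _; rewrite rmorphM.
exact: phi_comm.
Qed.

Lemma prod_morph_tensor (B : I -> finType) (b : forall o, B o -> A o) :
  (forall o, spanning (@b o)) ->
  is_basis (fun beta : {dffun forall o, B o} => \prod_o phi o (b o (beta o))) ->
  is_tensor_product prod_morph.
Proof.
move=> spa bas; apply: (tensor_of_basis spa) => //.
- exact: prod_morph_multilinear.
- exact: prod_morph1.
exact: prod_morphM.
Qed.

End CommutingMorphisms.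

(** Putting 1 in all places but one embeds each factor. *)
Lemma tensor_inclusions (F : fieldType) (I : finType) (A : I -> algType F)
    (T : algType F) (t : (forall o, A o) -> T) : is_tensor_product t ->
  exists iota : forall o, {lrmorphism A o -> T},
    (forall o o' u v, o != o' -> iota o u * iota o' v = iota o' v * iota o u) /\
    (forall f, t f = \prod_o iota o (f o)).
Proof.
case=> tl _ t1 tM; pose one o : A o := 1.
have one_in o : dfwith one (1 : A o) = one by apply: (dfwith_same one o).
have P o : exists h : {lrmorphism A o -> T}, h =1 (fun u : A o => t (dfwith one u)).
  apply: lrmorphism_of_fun => [a u v||u v]; first exact: tl.
    by rewrite one_in.
  rewrite tM; congr t; apply: functional_extensionality_dep => o'.
  by case: (eqVneq o o') => [<-|ne]; rewrite ?dfwith_in ?dfwith_out // mulr1.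
pose iota o := projT1 (cid (P o)).
have iE o (u : A o) : iota o u = t (dfwith one u) by rewrite /iota; case: cid.
exists iota; split=> [o o' u v oo'|f].
  rewrite !iE !tM; congr t; apply: functional_extensionality_dep => o1.
  case: (eqVneq o o1) => [<-|ne]; first by rewrite [dfwith _ v _]dfwith_out 1?eq_sym // mulr1 mul1r.
  by rewrite [dfwith _ u _]dfwith_out // mulr1 mul1r.
have E s : uniq s -> \prod_(o <- s) iota o (f o) = t (fun o => if o \in s then f o else 1).
  elim: s => [|o s IH] /=; first by rewrite big_nil -t1.
  case/andP=> os us; rewrite big_cons IH // iE tM.
  congr t; apply: functional_extensionality_dep => o1; rewrite inE.
  case: (eqVneq o1 o) => [->|ne] /=.
    by rewrite dfwith_in (negPf os) mulr1.
  by rewrite dfwith_out 1?eq_sym // mul1r.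
rewrite E ?index_enum_uniq //; congr t; apply: functional_extensionality_dep => o.
by rewrite mem_index_enum.
Qed.

(** * Monomials and roots of unity *)

Section Rescaling.
Variables (p : nat) (F : fieldType) (I : finType) (A : algType F) (z : I -> A).
Variables (K : finType) (e : K -> {ffun I -> 'F_p}) (b : K -> A).
Hypothesis be : forall k, line z (e k) (b k).

Lemma line_coefs : exists d : K -> F, forall k, d k != 0 /\ b k = d k *: mono z (e k).
Proof.
have P k : exists d : F, d != 0 /\ b k = d *: mono z (e k).
  by have [d] := be k; exists d.
by have [d dP] := choice P; exists d.
Qed.

(** A family of distinct monomials, up to nonzero scalars, inherits
    independence. *)
Lemma line_independent : injective e -> independent (mono (p := p) z) -> independent b.
Proof.
move=> e_inj ind c c0 k.
have [d dP] := line_coefs.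
pose c' (v : {ffun I -> 'F_p}) := \sum_(k' | e k' == v) c k' * d k'.
have c'0 : \sum_v c' v *: mono z v = 0.
  rewrite -[RHS]c0 (partition_big e xpredT) //=; apply: eq_bigr => v _.
  rewrite scaler_suml; apply: eq_bigr => k' /eqP<-.
  by rewrite (dP k').2 scalerA.
have := ind c' c'0 (e k); rewrite /c' (big_pred1 k) => [|k']; last first.
  by rewrite /= (inj_eq e_inj).
by move/eqP; rewrite mulf_eq0 (negPf (dP k).1) orbF => /eqP.
Qed.

Lemma line_spanning (g : {ffun I -> 'F_p} -> K) :
  cancel g e -> spanning (mono (p := p) z) -> spanning b.
Proof.
move=> gK spa v; have [c ->] := spa v.
have [d dP] := line_coefs.
exists (fun k => \sum_(w | g w == k) c w / d k).
rewrite (partition_big g xpredT) //=; apply: eq_bigr => k _.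
rewrite scaler_suml; apply: eq_bigr => w /eqP <-.
by rewrite (dP _).2 gK scalerA mulfVK // (dP _).1.
Qed.

End Rescaling.

Section Root.
Variables (p : nat) (F : fieldType) (rho : F).
Hypotheses (p_pr : prime p) (rho_prim : p.-primitive_root rho).
Implicit Types a b : 'F_p.

Definition rexp a : F := rho ^+ (a : nat).

Lemma rexpD a b : rexp (a + b) = rexp a * rexp b.
Proof. by rewrite /rexp val_Fp_add // prim_expr_mod // exprD. Qed.

Lemma rexpM a b : rexp (a * b) = rexp a ^+ b.
Proof. by rewrite /rexp val_Fp_mul // prim_expr_mod // exprM. Qed.

Lemma rexp0 : rexp 0 = 1. Proof. by rewrite /rexp expr0. Qed.

Lemma rexp1 : rexp 1 = rho. Proof. by rewrite /rexp expr1. Qed.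

Lemma rexp_sum (I : Type) (s : seq I) (P : pred I) (f : I -> 'F_p) :
  rexp (\sum_(i <- s | P i) f i) = \prod_(i <- s | P i) rexp (f i).
Proof. exact: (big_morph rexp rexpD rexp0). Qed.

Lemma rexp_neq0 a : rexp a != 0.
Proof.
have := oner_neq0 F; rewrite -rexp0 -(addrN a) rexpD mulf_eq0 negb_or.
by case/andP.
Qed.

Lemma rexp_inj : injective rexp.
Proof.
move=> a b /eqP; rewrite /rexp (eq_prim_root_expr rho_prim) => /eqP ab.
by apply: val_inj; move: ab; rewrite !modn_small ?ltn_Fp.
Qed.

Lemma rexp_p a : rexp a ^+ p = 1.
Proof. by rewrite /rexp exprAC (prim_expr_order rho_prim) expr1n. Qed.

(** The relations are invariant under rescaling one generator by rho, so each
    generator carries an automorphism; the monomials are joint eigenvectors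
    with separating eigenvalues. *)
Lemma presents_basis (I : finType) (al : I -> F) (q : I -> I -> F)
    (A : algType F) (z : I -> A) :
  (forall i, al i != 0) -> (forall i j, q i j != 0) ->
  presents (@torus_rel p F I al q) z -> (forall a : A, generated z a) ->
  is_basis (mono (p := p) z).
Proof.
move=> al0 q0 [zP univ] gen; split; last exact: mono_spanning zP gen.
pose w i j : A := (if j == i then rho else 1) *: z j.
have wP i : torus_rel p al q (w i).
  split=> [j|j k]; last first.
    rewrite /w -!scalerAl -!scalerAr zP.2 !scalerA.
    by congr (_ *: _); rewrite [LHS]mulrC [LHS]mulrA mulrAC.
  rewrite exprZn zP.1; case: (j == i); first by rewrite (prim_expr_order rho_prim) scale1r.
  by rewrite expr1n scale1r.
have sP i : exists s : {linear A -> A}, forall v : {ffun I -> 'F_p},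
    s (mono z v) = rexp (v i) *: mono z v.
  have [[s sw] _] := univ A (w i) (wP i); exists s => v.
  rewrite /mono rmorph_prod (eq_bigr (fun j => (if j == i then rexp (v i) else 1) *:
    z j ^+ (v j : nat))) => [|j _].
    rewrite scaler_prod; congr (_ *: _).
    by rewrite -big_mkcond /= big_pred1_eq.
  rewrite rmorphXn /= sw exprZn; congr (_ *: _).
  by case: (eqVneq j i) => [->|_] //; rewrite expr1n.
have [s sE] := choice sP.
apply: (@eigen_independent _ _ _ (mono z) I s (fun i v => rexp (v i))) => //.
  by move=> v; apply: (line_neq0 p_pr zP al0 q0 (line_mono z v)).
move=> u v; case: (pickP (fun i => u i != v i)) => [i ui _|uv].
  by exists i; apply: contra ui => /eqP/rexp_inj->.
by case/eqP; apply/ffunP => i; apply/eqP/negbFE/uv.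
Qed.

End Root.

Section MonoComm.
Variables (p : nat) (F : fieldType) (I : finType) (al : I -> F) (q : I -> I -> F).
Variables (A : algType F) (z : I -> A).
Hypothesis zP : torus_rel p al q z.

Lemma mono_mono_comm (u v : {ffun I -> 'F_p}) :
  mono z u * mono z v = (\prod_i chi q i v ^+ (u i : nat)) *: (mono z v * mono z u).
Proof.
apply: scomm_prodl => i; apply: scomm_exprl; exact: gen_mono_comm zP i v.
Qed.

End MonoComm.

(** * Change of generators in a Clifford algebra *)

Section MonomialPower.
Variables (p : nat) (F : fieldType) (rho : F).
Hypotheses (p_pr : prime p) (rho_prim : p.-primitive_root rho).

Lemma prim2_root : p = 2%N -> rho = -1.
Proof.
move=> p2; have /eqP := prim_expr_order rho_prim; rewrite p2 sqrf_eq1.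
case/orP=> /eqP // rho1; have := eq_prim_root_expr rho_prim 0 1.
by rewrite rho1 expr0 expr1 eqxx p2.
Qed.

(** The binomial coefficient is a multiple of p unless p = 2, where r = 1 or
    r = -1: reordering a p-th power leaves no scalar except a sign for p = 2. *)
Lemma root_expr_bin (r : F) :
  r ^+ p = 1 -> (r^-1) ^+ 'C(p, 2) = if p == 2%N then r else 1.
Proof.
move=> rp; case: eqP => [p2|/eqP p2].
  have -> : 'C(p, 2) = 1%N by rewrite p2 binn.
  rewrite p2 in rp.
  rewrite expr1 -[LHS]mul1r -rp expr2 mulfK //.
  by apply: contra_eq_neq rp => ->; rewrite expr0n eq_sym oner_neq0.
have /dvdnP[d ->] : (p %| 'C(p, 2))%N by rewrite prime_dvd_bin //= ltn_neqAle eq_sym p2 prime_gt1.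
by rewrite mulnC exprM exprVn rp invr1 expr1n.
Qed.

(** Splitting off the first factor a from the product b of the others, ba is r
    times ab for a p-th root of unity r, and r to the power 'C(p, 2) is the
    contribution of the pairs that contain the first index. *)
Lemma ordered_product_power (n : nat) (A : algType F) (x : 'I_n -> A)
    (al : 'I_n -> F) (m : 'I_n -> 'I_n -> 'F_p) (e : 'I_n -> 'F_p) :
  (forall k, x k ^+ p = (al k)%:A) ->
  (forall i j, x i * x j = rexp rho (m i j) *: (x j * x i)) ->
  (\prod_(i < n) x i ^+ (e i : nat)) ^+ p =
  ((if p == 2%N then
     (-1) ^+ (\sum_(k < n) \sum_(l < n | (k < l)%N) m k l * e k * e l)%N else 1) *
   \prod_(j < n) al j ^+ (e j : nat))%:A.
Proof.
elim: n x al m e => [|n IH] x al m e xp xx.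
  by rewrite !big_ord0 expr1n if_same mulr1 scale1r.
rewrite big_ord_recl; set a := x ord0 ^+ _; set b := \prod_(i < n) _.
pose c := \prod_(l < n) rexp rho (m ord0 (lift ord0 l)) ^+ e (lift ord0 l).
have cp : (c ^+ e ord0) ^+ p = 1.
  rewrite exprAC -prodrXl big1 ?expr1n // => l _.
  by rewrite exprAC rexp_p // expr1n.
have ab : a * b = c ^+ e ord0 *: (b * a).
  by apply: scomm_exprl; apply: scomm_prodr => l; apply: scomm_exprr; apply: xx.
have ba : b * a = (c ^+ e ord0)^-1 *: (a * b).
  rewrite ab scalerA mulVf ?scale1r //.
  by apply: contra_eq_neq cp => ->; rewrite expr0n gtn_eqF ?prime_gt0 // eq_sym oner_neq0.
rewrite (expr_mul_scomm _ ba) root_expr_bin //.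
rewrite (IH _ (fun i => al (lift ord0 i)) (fun i j => m (lift ord0 i) (lift ord0 j))) //.
rewrite /a exprAC xp exprZn expr1n.
rewrite -scalerAl mul1r !scalerA; congr (_ *: _).
rewrite [X in _ = _ * X]big_ord_recl.
rewrite mulrACA; congr (_ * _).
case: eqP => [p2|_]; last by rewrite mulr1.
rewrite big_ord_recl exprD; congr (_ * _).
  rewrite [in RHS]big_mkcond big_ord_recl /= add0n /c -prodrXl -prodrXr.
  by apply: eq_bigr => l _; rewrite /rexp prim2_root // -!exprM mulnAC.
congr (_ ^+ _); apply: eq_bigr => k _.
rewrite [LHS]big_mkcond [RHS]big_mkcond big_ord_recl /= add0n.
by apply: eq_bigr => l _.
Qed.

End MonomialPower.

Lemma torus_rel_gen_elt (p : nat) (F : fieldType) (I : finType) (al : I -> F)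
    (q : I -> I -> F) (A : algType F) (z : I -> A) :
  torus_rel p al q z -> torus_rel p al q (gen_elt z).
Proof.
case=> zp zz; split=> [i|i j]; apply: val_inj => /=; last by rewrite -zz.
by case: (genalg_val_lrmorphism z) => f fE; rewrite -[LHS]fE rmorphXn /= fE; apply: zp.
Qed.

Lemma generated_prod (F : fieldType) (A : algType F) (I J : Type) (z : I -> A)
    (s : seq J) (f : J -> A) (k : J -> nat) :
  (forall j, generated z (f j)) -> generated z (\prod_(j <- s) f j ^+ k j).
Proof.
move=> fg; elim/big_ind: _ => [|a b|j _]; first exact: generated_one.
  exact: generated_mul.
elim: (k j) => [|m IH]; first by rewrite expr0; apply: generated_one.
by rewrite exprS; apply: generated_mul.
Qed.

Lemma generated0 (F : fieldType) (A : algType F) (I : Type) (z : I -> A) :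
  generated z 0.
Proof.
rewrite -(addNr 1) -scaleN1r; apply: generated_lin; exact: generated_one.
Qed.

Lemma generated_scale (F : fieldType) (A : algType F) (I : Type) (z : I -> A) c a :
  generated z a -> generated z (c *: a).
Proof. by move=> ga; rewrite -[_ *: _]addr0; apply: generated_lin ga (generated0 z). Qed.

Section CliffordAlgebra.
Variables (p : nat) (F : fieldType) (rho : F) (n : nat).
Variables (alpha : 'I_n -> F) (M : 'M['F_p]_n) (C : algType F) (x : 'I_n -> C).
Hypotheses (p_pr : prime p) (rho_prim : p.-primitive_root rho).
Hypothesis alpha_neq0 : forall k, alpha k != 0.
Hypothesis C_pres : presents (clifford_rel p rho alpha M) x.

Let q (E : 'M['F_p]_n) i j := rexp rho (E i j).

Let q_neq0 E i j : q E i j != 0.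
Proof. exact: rexp_neq0. Qed.

Let xP : torus_rel p alpha (q M) x := C_pres.1.

Lemma clifford_generated c : generated x c.
Proof.
exact: (presents_generated C_pres (torus_rel_gen_elt xP)).
Qed.

Lemma clifford_basis : is_basis (mono (p := p) x).
Proof.
apply: (presents_basis p_pr rho_prim alpha_neq0 (q_neq0 M)) clifford_generated.
exact: C_pres.
Qed.

Lemma chi_rexp (E : 'M['F_p]_n) i (v : {ffun 'I_n -> 'F_p}) :
  chi (q E) i v = rexp rho (\sum_j E i j * v j).
Proof. by rewrite rexp_sum //; apply: eq_bigr => j _; rewrite rexpM. Qed.

Variable D : 'M['F_p]_n.
Let y := monomials p x D.
Let beta := monomial_power p alpha M D.
Let d i : {ffun 'I_n -> 'F_p} := [ffun j => D i j].

Lemma monomials_mono i : y i = mono x (d i).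
Proof. by apply: eq_bigr => j _; rewrite ffunE. Qed.

Lemma monomial_power_neq0 i : beta i != 0.
Proof.
rewrite mulf_neq0 //; last by apply/prodf_neq0 => j _; rewrite expf_neq0.
by case: (p == 2%N); rewrite ?signr_eq0 ?oner_neq0.
Qed.

Lemma monomials_torus : torus_rel p beta (q (D *m M *m D^T)) y.
Proof.
split=> [i|i j].
  exact: (ordered_product_power p_pr rho_prim (fun j => D i j) xP.1 xP.2).
rewrite !monomials_mono (mono_mono_comm xP); congr (_ *: _).
rewrite -mulmxA /q mxE rexp_sum //; apply: eq_bigr => k _.
rewrite chi_rexp -rexpM // !ffunE mulrC mxE; congr (rexp _ (_ * _)).
by apply: eq_bigr => l _; rewrite !mxE ffunE.
Qed.

Hypothesis D_unit : D \in unitmx.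

Lemma monomials_mono_line (v : {ffun 'I_n -> 'F_p}) :
  line x [ffun j => \sum_i v i * D i j] (mono y v).
Proof.
have -> : [ffun j => \sum_i v i * D i j] = \sum_i d i *+ v i.
  apply/ffunP => j; rewrite ffunE sum_ffunE; apply: eq_bigr => i _.
  by rewrite ffunMnE ffunE -mulr_natl natr_Zp.
apply: (line_prod p_pr xP alpha_neq0 (q_neq0 M)) => i.
apply: (line_expr p_pr xP alpha_neq0 (q_neq0 M)).
by rewrite monomials_mono; apply: line_mono.
Qed.

Lemma row_mul_ffun (v : {ffun 'I_n -> 'F_p}) (B : 'M['F_p]_n) j :
  ((\row_i v i) *m B) ord0 j = \sum_i v i * B i j.
Proof. by rewrite mxE; apply: eq_bigr => i _; rewrite mxE. Qed.

(** The rows of the inverse of D express the x i, up to scalars, as monomials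
    in the y j. *)
Lemma monomials_generated c : generated y c.
Proof.
have gx i : generated y (x i).
  pose v : {ffun 'I_n -> 'F_p} := [ffun k => invmx D i k].
  have [e e0] := monomials_mono_line v.
  have [f f0 xE] := line_gen p_pr xP alpha_neq0 (q_neq0 M) i.
  have -> : [ffun j => \sum_k v k * D k j] = unit_exp i :> {ffun 'I_n -> 'F_p}.
    apply/ffunP => j; rewrite !ffunE.
    transitivity ((invmx D *m D) i j); last by rewrite mulVmx // mxE eq_sym.
    by rewrite mxE; apply: eq_bigr => k _; rewrite ffunE.
  move=> yE; have -> : x i = (f / e) *: mono y v.
    by rewrite yE xE scalerA mulfVK.
  by apply/generated_scale/generated_prod => k; apply: generated_gen.
elim: (clifford_generated c) => [i|| a u v _ IHu _ IHv | u v _ IHu _ IHv] //.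
- exact: generated_one.
- exact: generated_lin.
exact: generated_mul.
Qed.

Lemma monomials_basis : is_basis (mono (p := p) y).
Proof.
split; last exact: mono_spanning monomials_torus monomials_generated.
apply: (line_independent monomials_mono_line) clifford_basis.1 => u v uv.
apply/ffunP => i.
have : (\row_i u i) *m D = (\row_i v i) *m D.
  apply/rowP => j; rewrite !row_mul_ffun.
  by move/ffunP/(_ j): uv; rewrite !ffunE.
by move/(can_inj (mulmxK D_unit))/rowP/(_ i); rewrite !mxE.
Qed.

End CliffordAlgebra.

(** * The canonical factors *)

Lemma presents_ext (F : fieldType) (I : Type)
    (Rel Rel' : forall B : algType F, (I -> B) -> Prop) (A : algType F) (z : I -> A) :
  (forall (B : algType F) (w : I -> B), Rel B w <-> Rel' B w) ->
  presents Rel z -> presents Rel' z.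
Proof.
move=> RR' [Rz univ]; split; first by apply/RR'.
by move=> B w /RR'; apply: univ.
Qed.

Section Subfamily.
Variables (p : nat) (F : fieldType) (I J : finType) (al : I -> F) (q : I -> I -> F).
Variables (A : algType F) (y : I -> A) (j : J -> I) (z : J -> A).
Hypotheses (p_pr : prime p) (al0 : forall i, al i != 0).
Hypotheses (q0 : forall i i', q i i' != 0).
Hypotheses (yP : torus_rel p al q y) (zE : forall a, z a = y (j a)).

Definition extend_exp (v : {ffun J -> 'F_p}) : {ffun I -> 'F_p} :=
  \sum_a unit_exp (j a) *+ v a.

Lemma subfamily_line v : line y (extend_exp v) (mono z v).
Proof.
apply: (line_prod p_pr yP al0 q0) => a; apply: (line_expr p_pr yP al0 q0).
by rewrite zE; apply: (line_gen p_pr yP al0 q0).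
Qed.

Lemma subfamily_torus : torus_rel p (al \o j) (fun a b => q (j a) (j b)) z.
Proof. by split=> [a|a b]; rewrite !zE; [apply: yP.1 | apply: yP.2]. Qed.

Hypothesis j_inj : injective j.

Lemma extend_exp_in v a : extend_exp v (j a) = v a.
Proof.
rewrite sum_ffunE (bigD1 a) //= ffunMnE ffunE eqxx natr_Zp big1 ?addr0 // => b ba.
by rewrite ffunMnE ffunE (inj_eq j_inj) eq_sym (negPf ba) mul0rn.
Qed.

Hypothesis ind : independent (mono (p := p) y).

Lemma gen_elt_mono (v : {ffun J -> 'F_p}) : genalg_val (mono (gen_elt z) v) = mono z v.
Proof.
have [f fE] := genalg_val_lrmorphism z; rewrite -fE /mono rmorph_prod.
by apply: eq_bigr => a _; rewrite rmorphXn /= fE.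
Qed.

(** Inside the ambient algebra the monomials in the subfamily are among the
    monomials in all the generators, hence independent. *)
Lemma subfamily_gen_basis : is_basis (mono (p := p) (gen_elt z)).
Proof.
split; last first.
  exact: mono_spanning (torus_rel_gen_elt subfamily_torus) (@gen_elt_generated _ _ _ z).
have zind : independent (mono (p := p) z).
  apply: (line_independent subfamily_line) ind => u v uv; apply/ffunP => a.
  by rewrite -!extend_exp_in uv.
move=> c c0; apply: zind; have [f fE] := genalg_val_lrmorphism z.
transitivity (f (\sum_v c v *: mono (gen_elt z) v)); last by rewrite c0 linear0.
rewrite linear_sum; apply: eq_bigr => v _.
by rewrite linearZ /= fE gen_elt_mono.
Qed.

Lemma subfamily_presents :
  presents (@torus_rel p F J (al \o j) (fun a b => q (j a) (j b))) (gen_elt z).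
Proof.
have gP := torus_rel_gen_elt subfamily_torus; split=> // B w wP; split.
  exact: torus_universal gP wP (@gen_elt_generated _ _ _ z) subfamily_gen_basis.
move=> f g fw gw u; apply: (@generated_lrmorphism_eq _ _ _ _ (gen_elt z)).
  by move=> a; rewrite fw gw.
exact: gen_elt_generated.
Qed.

End Subfamily.

Section JointFamilies.
Variables (p : nat) (F : fieldType) (I O : finType) (J : O -> finType).
Variables (al : I -> F) (q : I -> I -> F) (A : algType F) (y : I -> A).
Variable idx : forall o, J o -> I.
Hypotheses (p_pr : prime p) (al0 : forall i, al i != 0).
Hypotheses (q0 : forall i i', q i i' != 0) (yP : torus_rel p al q y).
Hypothesis y_basis : is_basis (mono (p := p) y).
Hypotheses (idx_inj : forall o, injective (@idx o))
  (idx_neq : forall o o' (a : J o) (a' : J o'), o != o' -> idx a != idx a')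
  (idx_surj : forall i, exists o (a : J o), i = idx a).
Variable b : forall o, {ffun J o -> 'F_p} -> A.
Hypothesis b_line : forall o v, line y (extend_exp (@idx o) v) (b v).

(** When the generators are split into disjoint families, the products of
    monomials in the families are, up to scalars, the monomials in all the
    generators. *)
Lemma joint_basis :
  is_basis (fun beta : {dffun forall o, {ffun J o -> 'F_p}} => \prod_o b (beta o)).
Proof.
pose e (v : {dffun forall o, {ffun J o -> 'F_p}}) : {ffun I -> 'F_p} :=
  \sum_o extend_exp (@idx o) (v o).
have e_idx (v : {dffun forall o, {ffun J o -> 'F_p}}) o (a : J o) :
    e v (idx a) = v o a.
  rewrite sum_ffunE (bigD1 o) //= (extend_exp_in (@idx_inj o)).
  rewrite big1 ?addr0 // => o' o'o; rewrite sum_ffunE big1 // => a' _.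
  by rewrite ffunMnE ffunE eq_sym (negPf (idx_neq a' a o'o)) mul0rn.
have eP (v : {dffun forall o, {ffun J o -> 'F_p}}) :
    line y (e v) (\prod_o b (v o)).
  exact: (line_prod p_pr yP al0 q0).
split.
  apply: (line_independent eP) y_basis.1 => u v uv.
  by apply/ffunP => o; apply/ffunP => a; rewrite -!e_idx uv.
apply: (line_spanning eP (g := fun v => [ffun o => [ffun a => v (idx a)]])) y_basis.2.
move=> v; apply/ffunP => i; have [o [a ->]] := idx_surj i.
by rewrite e_idx !ffunE.
Qed.

End JointFamilies.

Section BlockIndices.
Variables (p n m : nat) (hm : (m.*2 <= n)%N).

Definition head_idx (a : 'I_m * bool) : 'I_n :=
  if a.2 then odd_idx hm a.1 else even_idx hm a.1.

(** The entries of H, its first row and column being indexed by false. *)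
Definition symp (a b : bool) : 'F_p :=
  if a == b then 0 else if b then -1 else 1.

Lemma val_head_idx a : head_idx a = (a.1.*2 + a.2)%N :> nat.
Proof. by case: a => k [] /=; rewrite ?addn1 ?addn0. Qed.

Lemma head_idx_inj : injective head_idx.
Proof.
move=> [k s] [l t] /(congr1 val); rewrite /= !val_head_idx /= => E.
have st : s = t by have := congr1 odd E; rewrite !oddD !odd_double; case: (s); case: (t).
rewrite {}st in E *; congr (_, _); apply: val_inj.
by move/addIn/double_inj: E.
Qed.

Lemma head_idx_lt a : (head_idx a < m.*2)%N.
Proof.
rewrite val_head_idx; case: a => k s /=.
have h : (k.*2 + s < k.+1.*2)%N by rewrite doubleS; case: s; rewrite ?addn1 ?addn0.
by apply: leq_trans h _; rewrite leq_double.
Qed.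

Lemma idx_cases (i : 'I_n) : (exists a, i = head_idx a) \/ (exists j : 'I_(n - m.*2), i = tail_idx j).
Proof.
case: (ltnP i m.*2) => im.
  have km : (i./2 < m)%N by rewrite -ltn_double (leq_ltn_trans _ im) // -{2}(odd_double_half i) leq_addl.
  left; exists (Ordinal km, odd i); apply: val_inj; rewrite /= val_head_idx /=.
  by rewrite addnC odd_double_half.
have jn : (i - m.*2 < n - m.*2)%N by rewrite ltn_sub2r // (leq_ltn_trans im).
by right; exists (Ordinal jn); apply: val_inj => /=; rewrite subnKC.
Qed.

Lemma tail_idx_inj : injective (@tail_idx n m).
Proof. by move=> j k /(congr1 val)/= /addnI jk; apply: val_inj. Qed.

Lemma head_tail_neq a (j : 'I_(n - m.*2)) : head_idx a != tail_idx j.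
Proof.
apply: contraTneq (head_idx_lt a) => ->.
by rewrite -leqNgt /= leq_addr.
Qed.

Lemma block_H_head a b :
  block_H 'F_p n m (head_idx a) (head_idx b) = if a.1 == b.1 then symp a.2 b.2 else 0.
Proof.
rewrite mxE !head_idx_lt !andbT !val_head_idx.
case: a b => [k s] [l t] /=; rewrite !oddD !odd_double /= /symp.
rewrite -(inj_eq val_inj) /=.
case: s; case: t => /=; rewrite ?addn1 ?addn0 ?if_same ?eqSS //.
- by rewrite (inj_eq double_inj).
- by rewrite (inj_eq double_inj) eq_sym.
have E : (l.*2 == k.*2.+1) = false.
  by apply: contra_eqF (odd_double l) => /eqP->; rewrite /= odd_double.
have E' : (k.*2 == l.*2.+1) = false.
  by apply: contra_eqF (odd_double k) => /eqP->; rewrite /= odd_double.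
by rewrite E E'.
Qed.

Lemma even_before_tail (i k : nat) : ~~ odd i -> (m.*2 + k)%N = i.+1 -> (i < m.*2)%N = false.
Proof.
move=> ei E; apply: contraNF ei => im; have : i.+1 = m.*2.
  by apply/eqP; rewrite eqn_leq im -E leq_addr.
by move/(congr1 odd); rewrite odd_double /= => /negbFE.
Qed.

Lemma block_H_tail (j : 'I_(n - m.*2)) i : block_H 'F_p n m (tail_idx j) i = 0.
Proof.
rewrite mxE /= ltnNge leq_addr !andbF /=; case: ifP => // /and3P[ei /eqP E].
by rewrite (even_before_tail ei E).
Qed.

Lemma block_H_tailr i (j : 'I_(n - m.*2)) : block_H 'F_p n m i (tail_idx j) = 0.
Proof.
rewrite mxE /= [(_ + j < _)%N]ltnNge leq_addr !andbF /=.
by case: ifP => // /and3P[ei /eqP E]; rewrite (even_before_tail ei E).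
Qed.

End BlockIndices.

Lemma index_enum_option (T : finType) :
  index_enum (option T) = None :: map Some (index_enum T).
Proof. by rewrite ![index_enum _]unlock unlock /= /option_enum unlock. Qed.

Section CanonicalFactors.
Variables (p : nat) (F : fieldType) (rho : F) (n m : nat) (hm : (m.*2 <= n)%N).
Variables (C : algType F) (y : 'I_n -> C) (beta : 'I_n -> F).
Hypotheses (p_pr : prime p) (rho_prim : p.-primitive_root rho).
Hypothesis beta_neq0 : forall i, beta i != 0.

Let q i j := rexp rho (block_H 'F_p n m i j).
Hypothesis yP : torus_rel p beta q y.
Hypothesis y_basis : is_basis (mono (p := p) y).

Let q_neq0 i j : q i j != 0.
Proof. exact: rexp_neq0. Qed.

Definition pair_idx (k : 'I_m) (b : 'I_2) : 'I_n := head_idx hm (k, b != 0).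

Lemma pair_idx_inj k : injective (pair_idx k).
Proof.
move=> a b /head_idx_inj[]; case: a => [[|[|]]] // ?; case: b => [[|[|]]] // ? _.
all: exact: val_inj.
Qed.

Lemma pair_familyE k b : pair_family hm y k b = y (pair_idx k b).
Proof. by rewrite /pair_family /pair_idx /head_idx; case: (b == 0). Qed.

Lemma pair_presents k :
  presents (cyclic_rel p rho (beta (even_idx hm k)) (beta (odd_idx hm k)))
    (gen_elt (pair_family hm y k)).
Proof.
apply: presents_ext (subfamily_presents p_pr beta_neq0 q_neq0 yP (pair_familyE k)
  (@pair_idx_inj k) y_basis.1) => B w.
have ord2 (a : 'I_2) : a = 0 \/ a = 1.
  by case: a => [[|[|]]] // ?; [left|right]; apply: val_inj.
have qE a b : q (pair_idx k a) (pair_idx k b) =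
    rexp rho (symp p (a != 0) (b != 0)).
  by rewrite /q /pair_idx block_H_head eqxx.
split=> [[wp ww]|[w0 w1 w10]].
  split; [exact: (wp 0) | exact: (wp 1)|].
  by rewrite ww qE /symp /= rexp1.
have w01 : w 0 * w 1 = rexp rho (-1 : 'F_p) *: (w 1 * w 0).
  by rewrite w10 scalerA -{2}(rexp1 p rho) -rexpD // addNr rexp0 scale1r.
split=> [a|a b]; first by case: (ord2 a) => ->.
rewrite qE /symp; case: (ord2 a) => ->; case: (ord2 b) => -> //=.
- by rewrite rexp0 scale1r.
by rewrite rexp0 scale1r.
Qed.

Lemma tail_presents :
  presents (commutative_rel p (fun j => beta (tail_idx j)))
    (gen_elt (tail_family (m := m) y)).
Proof.
apply: presents_ext (subfamily_presents p_pr beta_neq0 q_neq0 yP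
  (fun=> erefl) (@tail_idx_inj n m) y_basis.1) => B w.
have qE a b : q (tail_idx (m := m) a) (tail_idx (m := m) b) = 1.
  by rewrite /q block_H_tail rexp0.
split=> [[wp ww]|[wp ww]]; split=> // a b; first by rewrite ww qE scale1r.
by rewrite qE scale1r.
Qed.

Lemma tail_central (j : 'I_(n - m.*2)) i : y i * y (tail_idx j) = y (tail_idx j) * y i.
Proof. by rewrite yP.2 /q block_H_tailr rexp0 scale1r. Qed.

Lemma tail_commutative (u v : genalg (tail_family (m := m) y)) : u * v = v * u.
Proof.
apply: (generated_comm _ (gen_elt_generated u) (gen_elt_generated v)) => i j.
by apply: val_inj; rewrite /= /tail_family tail_central.
Qed.

Let J (o : option 'I_m) : finType := if o is Some _ then 'I_2 else 'I_(n - m.*2).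

Let idx o : J o -> 'I_n :=
  match o with Some k => pair_idx k | None => @tail_idx n m end.

Let fam o : J o -> C :=
  match o with Some k => pair_family hm y k | None => tail_family (m := m) y end.

Let b o : {ffun J o -> 'F_p} -> factor hm y o :=
  match o with
  | Some k => mono (gen_elt (pair_family hm y k))
  | None => mono (gen_elt (tail_family (m := m) y))
  end.

Let idx_inj o : injective (@idx o).
Proof. by case: o => [k|]; [apply: pair_idx_inj | apply: tail_idx_inj]. Qed.

Let idx_neq o o' (a : J o) (a' : J o') : o != o' -> idx a != idx a'.
Proof.
case: o o' a a' => [k|] [k'|] //= a a' kk'.
- by apply: contraNneq kk' => /head_idx_inj[->].
- exact: head_tail_neq.
by rewrite eq_sym; apply: head_tail_neq.
Qed.

Let idx_surj i : exists o (a : J o), i = idx a.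
Proof.
case: (idx_cases hm i) => [[[k s] ->]|[j ->]]; last by exists None, j.
exists (Some k), (if s then 1 else 0 : 'I_2).
by rewrite /= /pair_idx; case: s.
Qed.

Let fval o : factor hm y o -> C :=
  match o with
  | Some k => @genalg_val F C 'I_2 (pair_family hm y k)
  | None => @genalg_val F C 'I_(n - m.*2) (tail_family (m := m) y)
  end.

Let fval_ex o : exists f : {lrmorphism factor hm y o -> C}, f =1 @fval o.
Proof. by case: o => [k|]; apply: genalg_val_lrmorphism. Qed.

Let fam_idx o a : @fam o a = y (idx a).
Proof. by case: o a => [k|] a //=; rewrite pair_familyE. Qed.

Let fval_line o v : line y (extend_exp (@idx o) v) (fval (b v)).
Proof.
have -> : fval (b v) = mono (@fam o) v by case: o v => [k|] v; apply: gen_elt_mono.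
exact: (subfamily_line p_pr beta_neq0 q_neq0 yP (@fam_idx o)).
Qed.

Let b_spanning o : spanning (@b o).
Proof.
case: o => [k|] /=; first exact: (subfamily_gen_basis p_pr beta_neq0 q_neq0
  yP (pair_familyE k) (@pair_idx_inj k) y_basis.1).2.
exact: (subfamily_gen_basis p_pr beta_neq0 q_neq0
  yP (fun=> erefl) (@tail_idx_inj n m) y_basis.1).2.
Qed.

Let fval_comm o o' u v : o != o' -> @fval o u * @fval o' v = fval v * fval u.
Proof.
move=> oo'; have gen o1 (w : factor hm y o1) : generated (@fam o1) (fval w).
  by case: o1 w => [k|] w; apply: genalg_valP.
apply: generated_comm (gen o u) (gen o' v) => a a'; rewrite !fam_idx yP.2 /q.
suff -> : block_H 'F_p n m (idx a) (idx a') = 0 by rewrite rexp0 scale1r.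
case: o o' a a' oo' {u v} => [k|] [k'|] //= a a' kk'.
- by rewrite block_H_head /= ifN.
- by rewrite block_H_tailr.
by rewrite block_H_tail.
Qed.

Lemma factor_tensor : is_tensor_product (@factor_mul n m hm F C y).
Proof.
have [phi phiE] : exists phi : forall o, {lrmorphism factor hm y o -> C},
    forall o, phi o =1 @fval o.
  by exists (fun o => projT1 (cid (fval_ex o))) => o; case: cid.
have phi_comm o o' u v : o != o' -> phi o u * phi o' v = phi o' v * phi o u.
  by move=> oo'; rewrite !phiE fval_comm.
have -> : @factor_mul n m hm F C y = prod_morph phi.
  apply: functional_extensionality_dep => f.
  rewrite /prod_morph index_enum_option big_cons big_map phiE.
  under [X in _ = _ * X]eq_bigr do rewrite phiE.
  symmetry; apply: commr_prod => k _; exact: fval_comm.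
apply: (prod_morph_tensor phi_comm b_spanning).
apply: (joint_basis p_pr beta_neq0 q_neq0 yP y_basis idx_inj idx_neq idx_surj
  (b := fun o v => phi o (b v))).
by move=> o v; rewrite phiE; apply: fval_line.
Qed.

End CanonicalFactors.

(** * The Azumaya property *)

Section Sandwich.
Variables (A : nzRingType) (W J : finType) (y : W -> A) (s t : W -> J -> A).
Let z w u := \sum_j s w j * u * t w j.
Hypothesis z_central : forall w u v, z w u * v = v * z w u.
Hypothesis z_expand : forall u, u = \sum_w z w u * y w.

Let zc_in w u : z w u \in @center_pred A.
Proof. by apply/asboolP => v; apply: z_central. Qed.

Let zc w u : center A := Center (zc_in w u).

Let center_scaleE (c : center A) (u : over_center A) : c *: u = center_val c * u.
Proof. by []. Qed.

Let center_comm (c : center A) (u : A) : center_val c * u = u * center_val c.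
Proof. by case: c => c hc; move/asboolP: (hc). Qed.

Let zc_linear w (c : center A) (u v : over_center A) :
  zc w (c *: u + v) = c * zc w u + zc w v.
Proof.
apply: val_inj => /=; rewrite /z mulr_sumr -big_split /=; apply: eq_bigr => j _.
by rewrite center_scaleE mulrDr mulrDl !mulrA center_comm.
Qed.

(** The coordinates z w u of u are central and given by two-sided
    multiplications. So a module map phi satisfies
    phi u = \sum_w z w u * phi (y w), which is a two-sided multiplication; and a
    tensor \sum_i a i (x) b i equals \sum_w y w (x) (\sum_i z w (a i) * b i),
    where the inner sum is a sum of left multiples of values of
    u |-> \sum_i a i * u * b i. *)
Lemma azumaya_of_sandwich : azumaya (over_center A).
Proof.
split.
- exists #|W|.
  have [i iE] : exists i : {linear over_center A -> 'rV[center A]_#|W|},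
      i =1 (fun u => \row_l zc (enum_val l) u).
    by apply: linear_of_fun => c u v; apply/rowP => l; rewrite !mxE zc_linear.
  have [r rE] : exists r : {linear 'rV[center A]_#|W| -> over_center A},
      r =1 (fun x => \sum_(l < #|W|) x ord0 l *: (y (enum_val l) : over_center A)).
    apply: linear_of_fun => c u v; rewrite scaler_sumr -big_split /=.
    by apply: eq_bigr => l _; rewrite !mxE scalerDl scalerA.
  exists i, r => u; rewrite iE rE [RHS]z_expand [RHS](big_enum_val (A := W)) /=.
  by apply: eq_bigr => l _; rewrite mxE.
- move=> c /(_ 1) c1; apply: val_inj; rewrite /= -[LHS]mulr1; exact: c1.
- move=> phi; exists #|{: W * J}|.
  exists (fun l => s (enum_val l).1 (enum_val l).2).
  exists (fun l => t (enum_val l).1 (enum_val l).2 * phi (y (enum_val l).1)) => u.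
  rewrite {1}(z_expand u) linear_sum.
  rewrite -(big_enum_val (A := {: W * J}) (fun x => s x.1 x.2 * u * (t x.1 x.2 * phi (y x.1)))).
  rewrite -(pair_bigA _ (fun w j => s w j * u * (t w j * phi (y w)))) /=.
  apply: eq_bigr => w _; rewrite -[z w u * y w]/(zc w u *: (y w : over_center A)).
  rewrite linearZ /= center_scaleE /= /z mulr_suml.
  by apply: eq_bigr => j _; rewrite mulrA.
move=> k a b ab0 V g [gl gr].
have g0 v : g 0 v = 0 by have := gl 1 0 0 v; rewrite !scale1r !addr0 => /(canLR (addrK _)) <-; rewrite subrr.
have gsum (I : finType) (f : I -> over_center A) v : g (\sum_i f i) v = \sum_i g (f i) v.
  elim/big_rec2: _ => [|i x w _ <-]; first exact: g0.
  by have := gl 1 (f i) w v; rewrite !scale1r.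
have g0' v : g v 0 = 0 by have := gr 1 v 0 0; rewrite !scale1r !addr0 => /(canLR (addrK _)) <-; rewrite subrr.
have gsum' (I : finType) (f : I -> over_center A) v : g v (\sum_i f i) = \sum_i g v (f i).
  elim/big_rec2: _ => [|i x w _ <-]; first exact: g0'.
  by have := gr 1 v (f i) w; rewrite !scale1r.
have gcr (c : center A) u v : g (c *: u) v = g u (c *: v).
  have := gl c u 0 v; have := gr c u v 0; rewrite g0 g0' !addr0.
  by move=> -> ->.
transitivity (\sum_w g (y w) (\sum_i zc w (a i) *: (b i : over_center A))).
  under [RHS]eq_bigr do rewrite gsum'.
  rewrite exchange_big /=; apply: eq_bigr => i _.
  rewrite [in LHS](z_expand (a i)) gsum; apply: eq_bigr => w _.
  by rewrite -gcr.
rewrite big1 // => w _; rewrite (_ : \sum_i _ = 0) ?g0' //.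
transitivity (\sum_j s w j * \sum_i a i * t w j * b i).
  under [RHS]eq_bigr do rewrite mulr_sumr.
  rewrite exchange_big /=; apply: eq_bigr => i _.
  rewrite center_scaleE /= /z mulr_suml; apply: eq_bigr => j _.
  by rewrite !mulrA.
by rewrite big1 // => j _; rewrite ab0 mulr0.
Qed.

End Sandwich.

Section CliffordAzumaya.
Variables (p : nat) (F : fieldType) (rho : F) (n m : nat) (hm : (m.*2 <= n)%N).
Variables (C : algType F) (y : 'I_n -> C) (beta : 'I_n -> F).
Hypotheses (p_pr : prime p) (rho_prim : p.-primitive_root rho).
Hypothesis beta_neq0 : forall i, beta i != 0.

Let q i j := rexp rho (block_H 'F_p n m i j).
Hypothesis yP : torus_rel p beta q y.
Hypothesis y_gen : forall c, generated y c.
Hypothesis y_basis : is_basis (mono (p := p) y).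

Let q_neq0 i j : q i j != 0.
Proof. exact: rexp_neq0. Qed.

Lemma chi_head (a : 'I_m * bool) (v : {ffun 'I_n -> 'F_p}) :
  chi q (head_idx hm a) v =
  rexp rho (symp p a.2 (~~ a.2) * v (head_idx hm (a.1, ~~ a.2))).
Proof.
rewrite chi_rexp //; congr (rexp _ _).
rewrite (bigD1 (head_idx hm (a.1, ~~ a.2))) //= block_H_head eqxx big1 ?addr0 // => j ja.
case: (idx_cases hm j) ja => [[[k s] ->]|[i ->]] ja; last by rewrite block_H_tailr mul0r.
rewrite block_H_head /=; case: eqP => [ak|_]; last by rewrite mul0r.
suff -> : s = a.2 by rewrite /symp eqxx mul0r.
apply: contraNeq ja => sa; rewrite ak; apply/eqP; congr (head_idx _ (_, _)).
by case: (s) (a.2) sa => [] [].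
Qed.

Lemma chi_tail (j : 'I_(n - m.*2)) (v : {ffun 'I_n -> 'F_p}) : chi q (tail_idx j) v = 1.
Proof.
rewrite chi_rexp // big1 ?rexp0 // => i _.
by rewrite block_H_tail mul0r.
Qed.

Lemma symp_neq0 s : symp p s (~~ s) != 0.
Proof.
case: s; first exact: oner_neq0.
rewrite -[symp p _ _]/(-1) oppr_eq0; exact: oner_neq0.
Qed.

Let central (a : C) := forall b, a * b = b * a.

Lemma central_gen a : (forall i, y i * a = a * y i) -> central a.
Proof.
move=> ya b; symmetry; apply: (@generated_comm _ _ _ 'I_1 y (fun=> a)) (y_gen b) _.
  by move=> i _; apply: ya.
exact: (generated_gen _ ord0).
Qed.

Let inv_ex (v : {ffun 'I_n -> 'F_p}) :
  exists b, [/\ line y (- v) b, b * mono y v = 1 & mono y v * b = 1].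
Proof. exact: (line_unit p_pr yP beta_neq0 q_neq0 (line_mono y v)). Qed.

Definition conj_sum (Y' : {ffun 'I_n -> 'F_p} -> C) (u : C) : C :=
  \sum_v mono y v * u * Y' v.

(** Summing the conjugates by all monomials projects, up to a scalar, to the
    center. *)
Lemma conj_sum_central : exists Y' : {ffun 'I_n -> 'F_p} -> C,
  [/\ forall u, central (conj_sum Y' u),
      forall u, central u -> conj_sum Y' u = #|{ffun 'I_n -> 'F_p}|%:R *: u
    & forall (t : {ffun 'I_n -> 'F_p}) u i, line y t u -> chi q i t != 1 ->
        conj_sum Y' u = 0].
Proof.
have [Y' Y'P] := choice inv_ex; exists Y'; set pi := conj_sum Y'.
have cen u : central (pi u).
  apply: central_gen => i; rewrite /pi /conj_sum mulr_sumr mulr_suml.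
  rewrite [RHS](reindex_inj (addIr (unit_exp i))) /=; apply: eq_bigr => v _.
  have [_ Yv _] := Y'P v; have [_ Yw Yw'] := Y'P (v + unit_exp i).
  have E := gen_mul_mono p_pr yP i v; set c := mul_coef _ _ _ _ _ in E.
  have c0 : c != 0 by apply: mul_coef_neq0.
  have -> : Y' v = c^-1 *: (Y' (v + unit_exp i) * y i).
    have [_ _ Yv'] := Y'P v.
    rewrite -[RHS]mulr1 -Yv' mulrA -scalerAl -(mulrA _ (y i)) E.
    by rewrite -scalerAr Yw scalerA mulVf // scale1r mul1r.
  rewrite !mulrA E -!scalerAr -!scalerAl scalerA mulVf // scale1r.
  by rewrite !mulrA.
split=> // [u uc|t u i lu chi1].
  rewrite /pi /conj_sum (eq_bigr (fun=> u)) => [|v _]; first by rewrite sumr_const scaler_nat.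
  by rewrite -uc -mulrA; have [_ _ ->] := Y'P v; rewrite mulr1.
have [c cE] : exists c, pi u = c *: u.
  have dP v : exists d : F, mono y v * u * Y' v = d *: u.
    have [d _ uE] := lu; have [_ _ Yv] := Y'P v.
    exists (\prod_i0 chi q i0 t ^+ (v i0 : nat)).
    rewrite uE -scalerAr (mono_mono_comm yP) -!scalerAl.
    by rewrite -(mulrA (mono y t)) Yv mulr1 !scalerA mulrC.
  have [d dE] := choice dP.
  by exists (\sum_v d v); rewrite /pi /conj_sum scaler_suml; apply: eq_bigr.
have [d _ uE] := lu; have := cen u (y i).
have -> : y i * pi u = chi q i t *: (pi u * y i).
  by rewrite cE uE -!scalerAr (gen_mono_comm yP) -!scalerAl !scalerA mulrC.
move/eqP; rewrite -subr_eq0 -{1}[pi u * y i]scale1r -scalerBl scaler_eq0 subr_eq0.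
rewrite eq_sym (negPf chi1) /= => /eqP piy.
have [b [_ yb]] := gen_unit p_pr yP beta_neq0 q_neq0 i.
by rewrite -[LHS]mulr1 -yb mulrA piy mul0r.
Qed.

Let head v := extend_exp (p := p) (head_idx hm) v.

(** The averaged conjugation projects onto the center, which is spanned by the
    monomials with exponents in the tail. Applied to u times the inverse of the
    head monomial Z w, it extracts the coordinate of u along Z w, for C is free
    over its center with the monomials Z w as a basis. *)
Lemma clifford_azumaya : azumaya (over_center C).
Proof.
have [Y' [cen pic pi0]] := conj_sum_central; set pi := conj_sum Y' in cen pic pi0.
set N : F := _%:R in pic.
have N0 : N != 0.
  rewrite /N card_ffun card_Fp // !natrX expf_neq0 //.
  exact: prim_root_natf_neq0 rho_prim.
pose Z (w : {ffun 'I_m * bool -> 'F_p}) := mono (y \o head_idx hm) w : C.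
have ZP w : line y (head w) (Z w).
  exact: (subfamily_line p_pr beta_neq0 q_neq0 yP (fun=> erefl)).
have [Zi ZiP] := choice (fun w => line_unit p_pr yP beta_neq0 q_neq0 (ZP w)).
pose s (w : {ffun 'I_m * bool -> 'F_p}) (v : {ffun 'I_n -> 'F_p}) := N^-1 *: mono y v.
pose t w (v : {ffun 'I_n -> 'F_p}) := Zi w * Y' v.
have zE w u : \sum_v s w v * u * t w v = N^-1 *: pi (u * Zi w).
  rewrite /pi /conj_sum scaler_sumr; apply: eq_bigr => v _.
  by rewrite /s /t -!scalerAl !mulrA.
apply: (@azumaya_of_sandwich C _ _ Z s t) => [w u v|u].
  by rewrite zE -scalerAl -scalerAr cen.
under eq_bigr do rewrite zE -scalerAl.
have [c ->] := y_basis.2 u.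
have -> : \sum_w N^-1 *: (pi ((\sum_t0 c t0 *: mono y t0) * Zi w) * Z w) =
   \sum_t0 c t0 *: \sum_w N^-1 *: (pi (mono y t0 * Zi w) * Z w).
  under [RHS]eq_bigr do rewrite scaler_sumr.
  rewrite [RHS]exchange_big /=; apply: eq_bigr => w _.
  have -> : pi ((\sum_t0 c t0 *: mono y t0) * Zi w) =
      \sum_t0 c t0 *: pi (mono y t0 * Zi w).
    rewrite /pi /conj_sum; under [RHS]eq_bigr do rewrite scaler_sumr.
    rewrite exchange_big /=; apply: eq_bigr => v _.
    rewrite mulr_suml mulr_sumr mulr_suml; apply: eq_bigr => t0 _.
    by rewrite -scalerAl -scalerAr -scalerAl.
  rewrite mulr_suml scaler_sumr; apply: eq_bigr => t0 _.
  by rewrite -scalerAl !scalerA mulrC.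
apply: eq_bigr => t0 _; congr (_ *: _).
pose w0 : {ffun 'I_m * bool -> 'F_p} := [ffun a => t0 (head_idx hm a)].
have lin w : line y (t0 - head w) (mono y t0 * Zi w).
  apply: (line_mul p_pr yP beta_neq0 q_neq0 (line_mono y t0)).
  by have [] := ZiP w.
have head_in w a : head w (head_idx hm a) = w a.
  by apply: extend_exp_in; apply: head_idx_inj.
(* Only the head part w0 of the exponent t0 contributes. *)
rewrite (bigD1 w0) //= big1 ?addr0 => [|w ww0].
  rewrite pic; last first.
    apply: central_gen => i; have [d _ ->] := lin w0.
    rewrite -scalerAr (gen_mono_comm yP) -scalerAl; congr (_ *: _).
    suff -> : chi q i (t0 - head w0) = 1 by rewrite scale1r.
    case: (idx_cases hm i) => [[a ->]|[j ->]]; last exact: chi_tail.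
    by rewrite chi_head !ffunE head_in !ffunE addrN mulr0 rexp0.
  rewrite -scalerAl scalerA mulVf // scale1r -mulrA.
  by have [_ -> _] := ZiP w0; rewrite mulr1.
have [a wa] : exists a, w a != w0 a.
  apply/existsP; apply: contraNT ww0; rewrite negb_exists => /forallP E.
  by apply/eqP/ffunP => a; apply/eqP; have := E a; rewrite negbK.
rewrite (pi0 _ _ (head_idx hm (a.1, ~~ a.2)) (lin w)) ?mul0r ?scaler0 //.
rewrite chi_head /= negbK -surjective_pairing -(rexp0 p rho) (inj_eq (rexp_inj p_pr rho_prim)).
rewrite mulf_neq0 //; last by rewrite !ffunE head_in subr_eq0 eq_sym; move: wa; rewrite ffunE.
by rewrite -{2}[a.2]negbK symp_neq0.
Qed.

End CliffordAzumaya.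

(** * Normal form of alternating matrices *)

Section Alternating.
Variable K : fieldType.

(** This form of the condition is visibly stable under congruence, including
    for the diagonal entries in characteristic two. *)
Lemma skew_symmetricP (n : nat) (M : 'M[K]_n) :
  skew_symmetric M <-> exists N : 'M[K]_n, M = N - N^T.
Proof.
split=> [[M0 MN]|[N ->]]; last first.
  by split=> [i|i j]; rewrite !mxE ?subrr // opprB.
exists (\matrix_(i, j) if (i < j)%N then M i j else 0).
apply/matrixP => i j; rewrite !mxE; case: (ltngtP i j) => [ij|ji|/val_inj->].
- by rewrite subr0.
- by rewrite sub0r -MN.
by rewrite subr0 M0.
Qed.

Lemma skew_congruence (k n : nat) (M : 'M[K]_n) (E : 'M[K]_(k, n)) :
  skew_symmetric M -> skew_symmetric (E *m M *m E^T).
Proof.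
case/skew_symmetricP => N ->; apply/skew_symmetricP; exists (E *m N *m E^T).
by rewrite mulmxBr mulmxBl !trmx_mul trmxK mulmxA.
Qed.

Definition normalizable (n : nat) (M : 'M[K]_n) :=
  exists (m : nat) (D : 'M[K]_n),
    [/\ (m.*2 <= n)%N, D \in unitmx & block_H K n m = D *m M *m D^T].

Lemma normalizable_congr (n : nat) (M E : 'M[K]_n) :
  E \in unitmx -> normalizable (E *m M *m E^T) -> normalizable M.
Proof.
move=> uE [m [D [hm uD HD]]]; exists m, (D *m E); split=> //.
  by rewrite unitmx_mul uD.
by rewrite HD trmx_mul !mulmxA.
Qed.

Lemma normalizable0 (n : nat) : normalizable (0 : 'M[K]_n).
Proof.
exists 0%N, 1%:M; split; rewrite ?unitmx1 //.
rewrite mulmx0 mul0mx; apply/matrixP => i j; rewrite !mxE !ltn0 !andbF; done.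
Qed.

Let H : 'M[K]_2 := block_H K 2 1.

Lemma block_HS (n m : nat) :
  block_H K n.+2 m.+1 = block_mx H 0 0 (block_H K n m) :> 'M[K]_(2 + n).
Proof.
rewrite -[LHS](@submxK _ 2 n 2 n); congr (@block_mx _ 2 n 2 n _ _ _ _); apply/matrixP => i j; rewrite !mxE /=.
- by case: i j => [[|[|]] //= ?] [[|[|]] //= ?].
- by case: i => [[|[|]] //= ?]; rewrite ?andbF.
- by case: j => [[|[|]] //= ?]; rewrite ?andbF.
by rewrite !negbK !eqSS doubleS !ltnS.
Qed.

Lemma normalizable_split (n : nat) (M : 'M[K]_n) :
  normalizable M -> normalizable (block_mx H 0 0 M : 'M[K]_(2 + n)).
Proof.
case=> m [D [hm uD HD]]; exists m.+1, (block_mx 1%:M 0 0 D : 'M[K]_(2 + n)).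
split; first by rewrite doubleS !ltnS.
  by rewrite unitmxE det_ublock det1 mul1r -unitmxE.
rewrite block_HS HD tr_block_mx !mulmx_block !trmx0 trmx1.
by rewrite !(mulmx0, mul0mx, addr0, add0r, mulmx1, mul1mx).
Qed.

Lemma skew_drsubmx (n : nat) (M : 'M[K]_(2 + n)) :
  skew_symmetric M -> skew_symmetric (drsubmx M).
Proof. by case=> M0 MN; split=> [i|i j]; rewrite !mxE; [apply: M0 | apply: MN]. Qed.

Lemma skew_ursubmx (n : nat) (M : 'M[K]_(2 + n)) :
  skew_symmetric M -> ursubmx M = - (dlsubmx M)^T.
Proof. by case=> _ MN; apply/matrixP => i j; rewrite !mxE MN. Qed.

(** The leading block of size two is invertible: row operations clear the block
    below it, and then the block on its right vanishes by skew symmetry. *)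
Lemma leading_pair (n : nat) (M : 'M[K]_(2 + n)) :
  skew_symmetric M -> M (lshift n ord0) (lshift n ord_max) != 0 ->
  exists2 E : 'M[K]_(2 + n), E \in unitmx &
    exists M1 : 'M[K]_n, skew_symmetric M1 /\ E *m M *m E^T = block_mx H 0 0 M1.
Proof.
move=> sM; set c := M _ _ => c0; pose A := ulsubmx M.
have A00 : A 0 0 = 0 by rewrite !mxE sM.1.
have A11 : A 1 1 = 0 by rewrite !mxE sM.1.
have A01 : A 0 1 = c by rewrite !mxE; congr (M _ _); apply: val_inj.
have A10 : A 1 0 = - c by rewrite !mxE sM.2; congr (- M _ _); apply: val_inj.
have uA : A \in unitmx.
  rewrite unitmxE (expand_det_row _ 0) !big_ord_recl big_ord0 A00 mul0r add0r addr0.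
  rewrite /cofactor det_mx11 2![X in _ * (_ * X)]mxE.
  have -> : A (lift 0 0) (lift (lift ord0 ord0) 0) = A 1 0.
    by congr (A _ _); apply: val_inj.
  have -> : A 0 (lift ord0 ord0) = c by rewrite -A01; congr (A _ _); apply: val_inj.
  by rewrite A10 /= expr1 mulN1r opprK unitfE mulf_neq0.
pose P : 'M[K]_2 := diag_mx (\row_i if i == 0 then - c^-1 else 1).
pose X := - (dlsubmx M *m invmx A).
pose E : 'M[K]_(2 + n) := block_mx P 0 X 1%:M.
exists E.
  rewrite unitmxE det_lblock det1 mulr1 det_diag unitfE.
  by apply/prodf_neq0 => i _; rewrite mxE; case: (i == 0); rewrite ?oppr_eq0 ?invr_eq0 ?oner_neq0.
set M' := E *m M *m E^T; have sM' : skew_symmetric M' by apply: skew_congruence.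
exists (drsubmx M'); split; first exact: skew_drsubmx.
have EE : M' = block_mx (P *m A *m P^T) (ursubmx M') 0 (drsubmx M').
  rewrite -[LHS]submxK; congr block_mx.
    rewrite /M' /E -[M]submxK tr_block_mx !mulmx_block block_mxKul.
    by rewrite !mul0mx !addr0 trmx0 mulmx0 addr0.
  rewrite /M' /E -[M]submxK tr_block_mx !mulmx_block block_mxKdl trmx0 mulmx0 addr0.
  by rewrite /X mulNmx mulmxKV // mul1mx addNr mul0mx.
have -> : H = P *m A *m P^T.
  have ord2 (a : 'I_2) : a = 0 \/ a = 1.
    by case: a => [[|[|]]] // l; [left|right]; apply: val_inj.
  apply/matrixP => i j; rewrite tr_diag_mx mul_mx_diag mul_diag_mx 4!mxE.
  case: (ord2 i) => ->; case: (ord2 j) => -> /=.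
  - by rewrite !A00 mxE mulr0 mul0r.
  - by rewrite A01 !mxE /= mulr1 mulNr mulVf.
  - by rewrite A10 !mxE /= mul1r mulrNN mulfV.
  by rewrite !A11 mxE mulr0 mul0r.
by rewrite {1}EE skew_ursubmx // EE block_mxKdl trmx0 oppr0 block_mxKdr.
Qed.

(** A permutation moves a nonzero entry to the leading block; then induction
    applies to the complement. *)
Lemma alternating_normal_form (n : nat) (M : 'M[K]_n) :
  skew_symmetric M -> normalizable M.
Proof.
elim/ltn_ind: n M => n IH M sM.
have [->|M0] := eqVneq M 0; first exact: normalizable0.
have [[i j] /= Mij] : exists ij : 'I_n * 'I_n, M ij.1 ij.2 != 0.
  apply/existsP; apply: contraNT M0; rewrite negb_exists => /forallP E.
  apply/eqP/matrixP => i j; rewrite mxE; apply/eqP.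
  by have := E (i, j); rewrite negbK.
have ij : i != j by apply: contraNneq Mij => ->; rewrite sM.1.
case: n => [|[|n]] in IH M sM M0 i j Mij ij *; first by case: i {Mij ij}.
  by rewrite !ord1 eqxx in ij.
pose s0 := tperm ord0 i; pose j' := s0 j.
have s0i : s0 ord0 = i by rewrite tpermL.
have j'0 : ord0 != j'.
  by apply: contraNneq ij => j'0; rewrite -s0i j'0 /j' tpermK.
pose o1 : 'I_n.+2 := lift ord0 ord0; pose f := (tperm o1 j' * s0)%g.
have f0 : f ord0 = i by rewrite permM tpermD // eq_sym.
have f1 : f o1 = j by rewrite permM tpermL /j' tpermK.
apply: (normalizable_congr (unitmx_perm K f)).
set M' := _ *m _ *m _; have sM' : skew_symmetric M' by apply: skew_congruence.
have M'E a b : M' a b = M (f a) (f b).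
  by rewrite /M' tr_perm_mx -row_permE -col_permE !mxE.
have [||E uE [M1 [sM1 EM]]] := @leading_pair n M'.
- exact: sM'.
- have <- : M' ord0 o1 = M' (@lshift 2 n ord0) (@lshift 2 n ord_max).
    by congr (M' _ _); apply: val_inj.
  by rewrite M'E f0 f1.
apply: (normalizable_congr uE); rewrite EM; apply: normalizable_split.
exact: IH.
Qed.

End Alternating.

(** * Symplectic families *)

Lemma basis_rV (K : fieldType) (V : lmodType K) (I : finType) (b : I -> V) (N : nat) :
  is_basis b -> #|I| = N -> exists f : {linear V -> 'rV[K]_N}, bijective f.
Proof.
move=> bas <-.
have [f fb] := basis_linear_ex (fun i => delta_mx 0 (enum_rank i) : 'rV[K]_#|I|) bas.
pose g (x : 'rV[K]_#|I|) := \sum_i x 0 (enum_rank i) *: b i.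
have fE (c : I -> K) : f (\sum_i c i *: b i) = \row_l c (enum_val l).
  apply/rowP => l; rewrite linear_sum summxE (bigD1 (enum_val l)) //= linearZ /= fb !mxE.
  rewrite enum_valK !eqxx mulr1 big1 ?addr0 // => i il.
  rewrite linearZ /= fb !mxE eqxx /= [_ == _](_ : _ = false) ?mulr0 //.
  by apply: contraNF il => /eqP->; rewrite enum_rankK.
exists f, g => [v|x].
  have [c ->] := bas.2 v; rewrite fE /g; apply: eq_bigr => i _.
  by rewrite mxE enum_rankK.
by rewrite /g fE; apply/rowP => l; rewrite mxE enum_valK.
Qed.

Section Symplectic.
Variables (p : nat) (K : fieldType) (rho : K).
Hypotheses (p_pr : prime p) (rho_prim : p.-primitive_root rho).

Definition symp_coef (J : finType) (a b : J * bool) : K :=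
  if a.1 == b.1 then rexp rho (symp p a.2 b.2) else 1.

(** The relations between the generators x_k, y_k of a tensor product of cyclic
    algebras. *)
Definition symp_rel (J : finType) (a c : J -> K) (A : algType K) (X Y : J -> A) :=
  [/\ forall k, X k ^+ p = (a k)%:A, forall k, Y k ^+ p = (c k)%:A,
      forall k l, X k * X l = X l * X k, forall k l, Y k * Y l = Y l * Y k
    & forall k l, Y k * X l = (if k == l then rho else 1) *: (X l * Y k)].

(** The two families as one, indexed as in symp. *)
Definition merge_pair (J : Type) (T : Type) (a c : J -> T) (k : J * bool) : T :=
  if k.2 then c k.1 else a k.1.

Section OneFamily.
Variables (J : finType) (a c : J -> K).

Lemma symp_coef_neq0 (k l : J * bool) : symp_coef k l != 0.
Proof. by rewrite /symp_coef; case: ifP => _; rewrite ?rexp_neq0 ?oner_neq0. Qed.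

Lemma chi_symp (k : J * bool) (v : {ffun J * bool -> 'F_p}) :
  chi (@symp_coef J) k v = rexp rho (symp p k.2 (~~ k.2) * v (k.1, ~~ k.2)).
Proof.
rewrite /chi (bigD1 (k.1, ~~ k.2)) //= {1}/symp_coef eqxx -rexpM // big1 ?mulr1 //.
move=> [l t] lk; rewrite /symp_coef /=; case: eqP => [kl|_]; last by rewrite expr1n.
suff -> : t = k.2 by rewrite /symp eqxx rexp0 expr1n.
by apply: contraNeq lk => tk; rewrite kl; apply/eqP; congr (_, _); case: (t) (k.2) tk => [] [].
Qed.

Lemma symp_nondegenerate : nondegenerate p (@symp_coef J).
Proof.
move=> u v uv; have [k uk] : exists k, u k != v k.
  apply/existsP; apply: contraNT uv; rewrite negb_exists => /forallP E.
  by apply/eqP/ffunP => k; apply/eqP; have := E k; rewrite negbK.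
exists (k.1, ~~ k.2); rewrite !chi_symp /= negbK -surjective_pairing.
rewrite (inj_eq (rexp_inj p_pr rho_prim)); apply: contraNneq uk => /eqP.
by rewrite -subr_eq0 -mulrBr mulf_eq0 -{2}[k.2]negbK (negPf (symp_neq0 _ _)) /= subr_eq0.
Qed.

Lemma symp_rel_torus (A : algType K) (X Y : J -> A) :
  symp_rel a c X Y <->
  torus_rel p (merge_pair a c) (@symp_coef J) (merge_pair X Y).
Proof.
split=> [[Xp Yp XX YY YX]|[zp zz]].
  split=> [[k []]|[k s] [l t]]; [exact: Yp | exact: Xp |]; rewrite /symp_coef /merge_pair /=.
  case: s t => [] []; rewrite /symp /=.
  - by rewrite YY rexp0 if_same scale1r.
  - by rewrite YX rexp1.
  - rewrite YX eq_sym; case: eqP => _; rewrite ?scale1r // scalerA -{2}(rexp1 p rho).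
    by rewrite -rexpD // addNr rexp0 scale1r.
  by rewrite XX rexp0 if_same scale1r.
split=> [k|k|k l|k l|k l].
- exact: (zp (k, false)).
- exact: (zp (k, true)).
- have := zz (k, false) (l, false).
  by rewrite /symp_coef /symp /= rexp0 if_same scale1r.
- have := zz (k, true) (l, true).
  by rewrite /symp_coef /symp /= rexp0 if_same scale1r.
have := zz (k, true) (l, false).
by rewrite /symp_coef /symp /= rexp1.
Qed.

Hypotheses (a0 : forall k, a k != 0) (c0 : forall k, c k != 0).

Lemma merge_pair_neq0 (k : J * bool) : merge_pair a c k != 0.
Proof. by case: k => k []; [apply: c0 | apply: a0]. Qed.

Lemma symp_independent (A : algType K) (X Y : J -> A) :
  symp_rel a c X Y -> independent (mono (p := p) (merge_pair X Y)).
Proof.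
move/symp_rel_torus => zP.
apply: (nondegenerate_independent p_pr zP).
- exact: merge_pair_neq0.
- exact: symp_coef_neq0.
exact: symp_nondegenerate.
Qed.

Lemma card_symp_exp : #|{ffun J * bool -> 'F_p}| = (p ^ #|J| * p ^ #|J|)%N.
Proof. by rewrite card_ffun card_Fp // card_prod card_bool muln2 -addnn expnD. Qed.

(** Matrices of the least possible size have no room for more than the
    independent monomials. *)
Lemma symp_spanning_mx d (X Y : J -> 'M[K]_d.+1) :
  symp_rel a c X Y -> (d.+1 <= p ^ #|J|)%N -> spanning (mono (p := p) (merge_pair X Y)).
Proof.
move=> XY dJ; apply: independent_spanning_mx (symp_independent XY) _.
by rewrite card_symp_exp leq_mul.
Qed.

End OneFamily.
End Symplectic.

(** * Cutting down matrix representations *)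

Section Corner.
Variables (K : fieldType) (N d : nat) (Q : 'M[K]_(d.+1, N.+1)).
Hypothesis Q_free : row_free Q.

(** B is the matrix, in the basis given by the rows of Q, of the restriction of
    A to the row space of Q. *)
Definition restricts (A : 'M[K]_N.+1) (B : 'M[K]_d.+1) := B *m Q = Q *m A.

Lemma restricts_ex A : (Q *m A <= Q)%MS -> exists B, restricts A B.
Proof. by move=> QA; exists (Q *m A *m pinvmx Q); apply: mulmxKpV. Qed.

Lemma restricts_inj A B B' : restricts A B -> restricts A B' -> B = B'.
Proof. by move=> BQ B'Q; apply: (row_free_inj Q_free); rewrite /= BQ B'Q. Qed.

Lemma restrictsM A B A' B' :
  restricts A B -> restricts A' B' -> restricts (A * A') (B * B').
Proof. by move=> AB AB'; rewrite /restricts -mulmxA AB' mulmxA AB -mulmxA. Qed.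

Lemma restrictsZ c A B : restricts A B -> restricts (c *: A) (c *: B).
Proof. by move=> AB; rewrite /restricts -scalemxAl AB scalemxAr. Qed.

Lemma restrictsD A B A' B' :
  restricts A B -> restricts A' B' -> restricts (A + A') (B + B').
Proof. by move=> AB AB'; rewrite /restricts mulmxDl AB AB' mulmxDr. Qed.

Lemma restricts1 : restricts 1 1.
Proof. by rewrite /restricts mul1mx mulmx1. Qed.

Lemma restrictsX A B k : restricts A B -> restricts (A ^+ k) (B ^+ k).
Proof.
move=> AB; elim: k => [|k IH]; first by rewrite !expr0; apply: restricts1.
by rewrite !exprS; apply: restrictsM.
Qed.

Lemma restricts_pow A B k c : restricts A B -> A ^+ k = c%:A -> B ^+ k = c%:A.
Proof.
move=> AB Ak; apply: restricts_inj (restrictsX k AB) _.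
by rewrite Ak; apply: restrictsZ restricts1.
Qed.

Lemma restricts_scomm A B A' B' c : restricts A B -> restricts A' B' ->
  A * A' = c *: (A' * A) -> B * B' = c *: (B' * B).
Proof.
move=> AB AB' AA'; apply: restricts_inj (restrictsM AB AB') _.
by rewrite AA'; apply/restrictsZ/restrictsM.
Qed.

End Corner.

Section Cut.
Variables (p : nat) (K : fieldType) (rho : K).
Hypotheses (p_pr : prime p) (rho_prim : p.-primitive_root rho).

(** The eigenspaces of U for the powers of rho are permuted cyclically by Y, so
    they have the same dimension, at most N.+1 / p. *)
Lemma cut_one (N : nat) (U Y : 'M[K]_N.+1) :
  U ^+ p = 1 -> Y \in unitmx -> Y * U = rho *: (U * Y) ->
  exists (d : nat) (Q : 'M[K]_(d.+1, N.+1)),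
    [/\ row_free Q, (d.+1 * p <= N.+1)%N, Q *m U = Q
      & forall A, A * U = U * A -> (Q *m A <= Q)%MS].
Proof.
move=> Up uY YU; pose E i := eigenspace U (rho ^+ i).
have EY i : (E i *m Y <= E i.+1)%MS.
  apply/eigenspaceP; rewrite -mulmxA -[Y *m U]/(Y * U) YU -scalemxAr mulmxA.
  have /eigenspaceP-> : (E i <= E i)%MS by [].
  by rewrite -scalemxAl scalerA -exprS.
have rE i k : (\rank (E i) <= \rank (E (i + k)%N))%N.
  elim: k => [|k IH]; first by rewrite addn0.
  rewrite addnS; apply: leq_trans IH _; apply: leq_trans (mxrankS (EY _)).
  by rewrite mxrankMfree // row_free_unit.
have p_gt0 := prime_gt0 p_pr.
have E0 : E 0%N != 0.
  apply: contraTneq isT => E0z.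
  have Ez i : (i < p)%N -> U - (rho ^+ i)%:M \in unitmx.
    move=> ip; rewrite -row_free_unit -kermx_eq0 -mxrank_eq0 -leqn0.
    have := rE i (p - i)%N; rewrite subnKC ?(ltnW ip) // /E (prim_expr_order rho_prim) => /leq_trans; apply.
    by move: E0z; rewrite /E expr0 => ->; rewrite mxrank0.
  have := congr1 (horner_mx U) (factor_Xn_sub_1 rho_prim).
  rewrite rmorph_prod rmorphB rmorphXn /= horner_mx_X Up rmorph1 subrr.
  rewrite big_nat; move=> prod0.
  have : \prod_(0 <= i < p | (0 <= i < p)%N) horner_mx U ('X - (rho ^+ i)%:P) \in GRing.unit.
    apply: rpred_prod => i /andP[_ ip]; rewrite rmorphB /= horner_mx_X horner_mx_C.
    exact: Ez.
  by rewrite prod0 unitr0.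
have E_rank : (\rank (E 0%N) * p <= N.+1)%N.
  have inj : {in xpredT &, injective (fun i : 'I_p => rho ^+ i)}.
    move=> i j _ _ /eqP; rewrite (eq_prim_root_expr rho_prim) !modn_small // => /eqP.
    exact: val_inj.
  have /mxdirectP := mxdirect_sum_eigenspace U inj => /= rs.
  apply: leq_trans (rank_leq_row (\sum_(i < p) eigenspace U (rho ^+ i))%MS).
  rewrite rs -[p in (_ * p)%N]card_ord mulnC -sum_nat_const.
  by apply: leq_sum => i _; have := rE 0%N i; rewrite add0n.
have [Q Qf QE] : exists2 Q : 'M[K]_(\rank (E 0%N), N.+1), row_free Q & (Q :=: E 0%N)%MS.
  by exists (row_base (E 0%N)); [apply: row_base_free | apply: eq_row_base].
move: E_rank Q Qf QE; rewrite -mxrank_eq0 in E0.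
case: (\rank (E 0%N)) E0 => // d _ dp Q Qf QE; exists d, Q.
have QU : Q *m U = Q.
  have /eigenspaceP : (Q <= eigenspace U (rho ^+ 0))%MS by rewrite QE.
  by rewrite expr0 scale1r.
split=> // A AU; rewrite QE; apply/eigenspaceP; rewrite expr0 scale1r.
by rewrite -mulmxA -[A *m U]/(A * U) AU mulmxA QU.
Qed.

(** Cutting by one U after the other: the remaining ones, and their partners Y,
    commute with it and so restrict to the eigenspace. *)
Lemma cut_many (N : nat) (J : finType) (U Y : J -> 'M[K]_N.+1) (s : seq J) :
  (forall j, U j ^+ p = 1) -> (forall j, Y j \in unitmx) ->
  (forall i j, U i * U j = U j * U i) ->
  (forall i j, Y i * U j = (if i == j then rho else 1) *: (U j * Y i)) ->
  uniq s ->
  exists (d : nat) (Q : 'M[K]_(d.+1, N.+1)),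
    [/\ row_free Q, (d.+1 * p ^ size s <= N.+1)%N
      & forall A, (forall j, j \in s -> A * U j = U j * A) -> (Q *m A <= Q)%MS].
Proof.
move=> Up uY UU YU; elim: s => [_|j s IH /= /andP[js us]].
  exists N, 1%:M; split; [by rewrite row_free_unit unitmx1 | by rewrite expn0 muln1 |].
  by move=> A _; rewrite mul1mx submx1.
have [d' [Q' [Q'f dQ' Q'A]]] := IH us.
have [U' UU'] : exists U', restricts Q' (U j) U' by apply/restricts_ex/Q'A.
have YjU i : i \in s -> Y j * U i = U i * Y j.
  by move=> is_; rewrite YU ifN ?scale1r //; apply: contraNneq js => ->.
have [Y' YY'] : exists Y', restricts Q' (Y j) Y' by apply/restricts_ex/Q'A.
have uY' : Y' \in unitmx.
  have Yf : row_free (Y j) by rewrite row_free_unit uY.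
  rewrite -row_free_unit /row_free -(mxrankMfree _ Q'f) YY' (mxrankMfree _ Yf).
  exact: Q'f.
have U'p : U' ^+ p = 1.
  by rewrite -(scale1r 1); apply: restricts_pow UU' _; rewrite ?Up ?scale1r.
have Y'U' : Y' * U' = rho *: (U' * Y').
  by apply: (restricts_scomm Q'f YY' UU'); rewrite YU eqxx.
have [d [Q1 [Q1f dQ1 _ Q1A]]] := cut_one U'p uY' Y'U'.
exists d, (Q1 *m Q'); split.
- by rewrite /row_free mxrankMfree.
- by rewrite expnS mulnA (leq_trans _ dQ') // leq_mul2r dQ1 orbT.
move=> A AU; have [A' AA'] : exists A', restricts Q' A A'.
  by apply/restricts_ex/Q'A => i is_; apply: AU; rewrite inE is_ orbT.
rewrite -mulmxA -AA' mulmxA submxMr //; apply: Q1A.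
rewrite -[RHS]scale1r; apply: (restricts_scomm Q'f AA' UU').
by rewrite scale1r AU // inE eqxx.
Qed.

End Cut.

(** * Split symplectic families *)

Lemma prod_expr_commute (R : pzRingType) (I : Type) (s : seq I) (f : I -> R) k :
  (forall i j, f i * f j = f j * f i) ->
  (\prod_(i <- s) f i) ^+ k = \prod_(i <- s) f i ^+ k.
Proof.
move=> ff; elim: s => [|i s IH]; first by rewrite !big_nil expr1n.
rewrite !big_cons exprMn_comm ?IH //; apply: commr_prod => j _; exact: ff.
Qed.

Lemma prod_in_alg (R : comNzRingType) (A : algType R) (I : Type) (s : seq I) (c : I -> R) :
  \prod_(i <- s) (c i)%:A = (\prod_(i <- s) c i)%:A :> A.
Proof. by rewrite -[RHS]/(in_alg A _) rmorph_prod. Qed.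

Section Split.
Variables (p : nat) (K : fieldType) (rho : K).
Hypotheses (p_pr : prime p) (rho_prim : p.-primitive_root rho).

(** There is a matrix representation of dimension at most p ^ #|J|; the algebra
    generated by such a symplectic family, whose dimension is the square of
    p ^ #|J|, is then a matrix algebra. *)
Definition split_by (J : finType) (a c : J -> K) :=
  exists (d : nat) (X Y : J -> 'M[K]_d.+1),
    (d.+1 <= p ^ #|J|)%N /\ symp_rel p rho a c X Y.

Lemma expr_unitmx N (A : 'M[K]_N.+1) (c : K) : c != 0 -> A ^+ p = c%:A -> A \in unitmx.
Proof.
move=> c0 Ap; have : A ^+ p \in GRing.unit.
  by rewrite Ap scaler_unit ?unitr1 // unitfE.
by rewrite unitrX_pos // prime_gt0.
Qed.

Section Fold.
Variables (J E : finType) (a : J -> K) (c : option E * J -> K) (N : nat).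
Variables (X Y : option E * J -> 'M[K]_N.+1).
Hypotheses (a0 : forall k, a k != 0) (c0 : forall k, c k != 0).
Hypothesis XY : symp_rel p rho (fun k => a k.2) c X Y.

Let U (k : E * J) := (a k.2)^-1 *: (X (Some k.1, k.2) * X (None, k.2) ^+ p.-1).

Let Xcomm k l : X k * X l = X l * X k.
Proof. by case: XY. Qed.

Let UX k l : X l * U k = U k * X l.
Proof.
rewrite /U -scalerAr -scalerAl; congr (_ *: _).
by apply/commrM; [apply: Xcomm | apply/commrX/Xcomm].
Qed.

Let UU k l : U k * U l = U l * U k.
Proof.
rewrite {1 4}/U -[LHS]scalerAl -[RHS]scalerAr; congr (_ *: _).
apply: commr_sym; apply: commrM; first by apply: commr_sym; apply: UX.
by apply: commrX; apply: commr_sym; apply: UX.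
Qed.

Let Up k : U k ^+ p = 1.
Proof.
have [Xp _ _ _ _] := XY; rewrite /U exprZn exprMn_comm; last exact/commrX/Xcomm.
rewrite exprAC !Xp exprZn expr1n -scalerAl mul1r !scalerA -mulrA -exprS prednK ?prime_gt0 //.
by rewrite -exprMn mulVf // expr1n scale1r.
Qed.

Let YU k l : Y k * U l =
  ((if k == (Some l.1, l.2) then rho else 1) *
   (if k == (None, l.2) then rho else 1) ^+ p.-1) *: (U l * Y k).
Proof.
have [_ _ _ _ YX] := XY; rewrite /U -scalerAr mulrA YX -scalerAl -(mulrA (X _)).
rewrite (scomm_exprr _ (YX k (None, l.2))) -scalerAr -!scalerAl !scalerA mulrA.
by congr (_ *: _); rewrite [RHS]mulrC mulrA.
Qed.

(** The quotients U of the elements X by those of the base family have p-th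
    power 1. Their common eigenspace for the eigenvalue 1 is stable under the
    base family of X and under the products of the families of Y, which form a
    symplectic family there. This is the tensor product relation
    (a, c) (x) (a, c') ~ (a, cc') of cyclic algebras. *)
Lemma split_fold : (N.+1 <= p ^ (#|J| * #|E|.+1))%N ->
  split_by a (fun k => \prod_o c (o, k)).
Proof.
move=> Np; have [Xp Yp XX YY YX] := XY.
pose V (k : E * J) := Y (Some k.1, k.2).
have uV k : V k \in unitmx by apply: (expr_unitmx (c0 _) (Yp _)).
have VU k l : V k * U l = (if k == l then rho else 1) *: (U l * V k).
  by case: k l => [e k] [f l]; rewrite /V YU !xpair_eqE /= expr1n mulr1.
have prod_delta (o0 : option E) (k l : J) :
    \prod_o (if (o, k) == (o0, l) then rho else 1) = if k == l then rho else 1.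
  rewrite (bigD1 o0) //= xpair_eqE eqxx big1 ?mulr1 // => o oo0.
  by rewrite xpair_eqE (negPf oo0).
have [d [Q [Qf dQ QA]]] := cut_many p_pr rho_prim Up uV UU VU (enum_uniq {: E * J}).
pose Yt k := \prod_o Y (o, k).
have YtU k l : Yt k * U l = U l * Yt k.
  rewrite /Yt (scomm_prodl _ (fun o => YU (o, k) l)) big_split /= prodrXl.
  rewrite (prod_delta (Some l.1)) (prod_delta None) -exprS prednK ?prime_gt0 //.
  by case: (k == l.2); rewrite ?(prim_expr_order rho_prim) ?expr1n scale1r.
have X0U k l : X (None, k) * U l = U l * X (None, k) by apply: UX.
have [Xr XrP] := choice (fun k => restricts_ex (QA _ (fun l _ => X0U k l))).
have [Yr YrP] := choice (fun k => restricts_ex (QA _ (fun l _ => YtU k l))).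
exists d, Xr, Yr; split.
  move: dQ; rewrite -cardE card_prod => dQ.
  have : (d.+1 * p ^ (#|E| * #|J|) <= p ^ #|J| * p ^ (#|E| * #|J|))%N.
    by apply: leq_trans dQ _; apply: leq_trans Np _; rewrite -expnD -mulSn mulnC.
  by rewrite leq_pmul2r // expn_gt0 prime_gt0.
have commr (A B : 'M[K]_N.+1) (A' B' : 'M[K]_d.+1) :
    restricts Q A A' -> restricts Q B B' -> A * B = B * A -> A' * B' = B' * A'.
  move=> AA' BB' AB; rewrite -[RHS]scale1r; apply: (restricts_scomm Qf AA' BB').
  by rewrite scale1r.
split=> [k|k|k l|k l|k l].
- by apply: (restricts_pow Qf (XrP k)); apply: Xp.
- apply: (restricts_pow Qf (YrP k)).
  rewrite /Yt prod_expr_commute => [|o o']; last exact: YY.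
  by rewrite -prod_in_alg; apply: eq_bigr => o _; apply: Yp.
- by apply: commr (XrP k) (XrP l) _; apply: XX.
- apply: commr (YrP k) (YrP l) _.
  by apply/commr_prod => o _; apply: commr_sym; apply/commr_prod => o' _; apply: YY.
apply: (restricts_scomm Qf (YrP k) (XrP l)).
rewrite /Yt (scomm_prodl _ (fun o => YX (o, k) (None, l))); congr (_ *: _).
exact: (prod_delta None).
Qed.

End Fold.
End Split.

Section SplitCalculus.
Variables (p : nat) (K : fieldType) (rho : K).
Hypotheses (p_pr : prime p) (rho_prim : p.-primitive_root rho).

Local Notation tens := mxtens.tensmx.

Lemma tensor_morphisms d d' : exists N : nat, N.+1 = (d.+1 * d'.+1)%N /\
  exists (L : {lrmorphism 'M[K]_d.+1 -> 'M[K]_N.+1})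
         (R : {lrmorphism 'M[K]_d'.+1 -> 'M[K]_N.+1}),
    forall A B, L A * R B = R B * L A.
Proof.
pose N := (d' + d * d'.+1)%N; exists N; split=> //.
have tens_linl (B : 'M[K]_d'.+1) : linear (fun A : 'M[K]_d.+1 => tens A B : 'M[K]_N.+1).
  by move=> c A A'; apply/matrixP => i j; rewrite !mxE mulrDl mulrA.
have tens_linr (A : 'M[K]_d.+1) : linear (fun B : 'M[K]_d'.+1 => tens A B : 'M[K]_N.+1).
  by move=> c B B'; apply/matrixP => i j; rewrite !mxE mulrDr mulrCA.
have tensM (A A' : 'M[K]_d.+1) (B B' : 'M[K]_d'.+1) :
    tens (A * A') (B * B') = (tens A B : 'M[K]_N.+1) * tens A' B' :> 'M[K]_N.+1.
  exact: (esym (@mxtens.tensmx_mul K _ _ _ _ _ _ A B A' B')).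
have tens1 : tens (1 : 'M[K]_d.+1) (1 : 'M[K]_d'.+1) = 1 :> 'M[K]_N.+1.
  apply/matrixP => i j; rewrite !mxE -natrM mulnb.
  by rewrite -[in RHS](inj_eq (can_inj (@mxtens.mxtens_unindexK d.+1 d'.+1))) xpair_eqE.
have [|L LE] := lrmorphism_of_fun (tens_linl 1) tens1.
  by move=> A A'; rewrite -tensM mulr1.
have [|R RE] := lrmorphism_of_fun (tens_linr 1) tens1.
  by move=> B B'; rewrite -tensM mulr1.
by exists L, R => A B; rewrite LE RE -!tensM !mul1r !mulr1.
Qed.

Variable J : finType.
Implicit Types a c : J -> K.

(** Tensoring two representations and folding the two families. *)
Lemma split_mul a c c' : (forall k, a k != 0) -> (forall k, c k != 0) ->
  (forall k, c' k != 0) ->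
  split_by p rho a c -> split_by p rho a c' -> split_by p rho a (fun k => c k * c' k).
Proof.
move=> a0 c0 c'0 [d [X [Y [dJ XY]]]] [d' [X' [Y' [dJ' XY']]]].
have [N [NE [L [R LR]]]] := tensor_morphisms d d'.
pose glue (Z : J -> 'M[K]_d.+1) (Z' : J -> 'M[K]_d'.+1) (k : option unit * J) :=
  if k.1 is Some _ then R (Z' k.2) else L (Z k.2).
pose cc (k : option unit * J) := if k.1 is Some _ then c' k.2 else c k.2.
have Lp (A : 'M[K]_d.+1) e : A ^+ p = e%:A -> L A ^+ p = e%:A.
  by move=> Ap; rewrite -rmorphXn /= Ap linearZ /= rmorph1.
have Rp (A : 'M[K]_d'.+1) e : A ^+ p = e%:A -> R A ^+ p = e%:A.
  by move=> Ap; rewrite -rmorphXn /= Ap linearZ /= rmorph1.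
have [Xp Yp XX YY YX] := XY; have [Xp' Yp' XX' YY' YX'] := XY'.
have gl : symp_rel p rho (fun k => a k.2) cc (glue X X') (glue Y Y').
  split=> [[[u|] k]|[[u|] k]|[[u|] k] [[v|] l]|[[u|] k] [[v|] l]|[[u|] k] [[v|] l]];
    rewrite /glue /=.
  - exact: Rp.
  - exact: Lp.
  - exact: Rp.
  - exact: Lp.
  - by rewrite -!rmorphM /= XX'.
  - by rewrite LR.
  - by rewrite LR.
  - by rewrite -!rmorphM /= XX.
  - by rewrite -!rmorphM /= YY'.
  - by rewrite LR.
  - by rewrite LR.
  - by rewrite -!rmorphM /= YY.
  - by rewrite -!rmorphM /= YX' linearZ /=; case: u v => [] [].
  - by rewrite LR scale1r.
  - by rewrite LR scale1r.
  by rewrite -!rmorphM /= YX linearZ.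
have cc0 k : cc k != 0 by case: k => [[u|] k]; [apply: c'0 | apply: c0].
have NJ : (N.+1 <= p ^ (#|J| * #|{: unit}|.+1))%N.
  by rewrite NE card_unit muln2 -addnn expnD leq_mul.
have [d1 [X1 [Y1 [dJ1 XY1]]]] := split_fold p_pr rho_prim a0 cc0 gl NJ.
exists d1, X1, Y1; split=> //; have ccE k : \prod_o cc (o, k) = c k * c' k.
  rewrite (bigD1 None) //= (bigD1 (Some tt)) //= big1 ?mulr1 //.
  by case=> [[]|].
by move: XY1; under eq_fun do rewrite ccE.
Qed.

Lemma split_scale a c e : split_by p rho a c ->
  split_by p rho a (fun k => c k * e k ^+ p).
Proof.
move=> [d [X [Y [dJ [Xp Yp XX YY YX]]]]]; exists d, X, (fun k => e k *: Y k).
split=> //; split=> // [k|k l|k l].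
- by rewrite exprZn Yp scalerA mulrC.
- by rewrite -!scalerAl -!scalerAr YY scalerA mulrC -scalerA.
by rewrite -!scalerAl -!scalerAr YX !scalerA mulrC.
Qed.

Lemma split_exp a c u : (forall k, a k != 0) -> (forall k, c k != 0) ->
  split_by p rho a c -> split_by p rho a (fun k => c k ^+ u.+1).
Proof.
move=> a0 c0 ac; elim: u => [|u IH]; first by under eq_fun do rewrite expr1.
under eq_fun do rewrite exprS; apply: split_mul => // k.
exact: expf_neq0.
Qed.

(** The exponent e is invertible modulo p, and p-th powers can be absorbed by
    rescaling Y. *)
Lemma split_coprime a c e : (forall k, a k != 0) -> (forall k, c k != 0) ->
  (0 < e < p)%N ->
  split_by p rho a (fun k => c k ^+ e) -> split_by p rho a c.
Proof.
move=> a0 c0 /andP[e0 ep] ace; case: (egcdnP p e0) => u v uv _.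
have co : gcdn e p = 1%N.
  by apply/eqP; rewrite -/(coprime e p) coprime_sym prime_coprime // gtnNdvd.
case: u uv => [|u] uv; first by rewrite mul0n co addn1 in uv.
have ce0 k : c k ^+ e != 0 by rewrite expf_neq0.
have := split_scale (fun k => (c k ^+ v)^-1) (split_exp u a0 ce0 ace).
congr split_by; apply: functional_extensionality_dep => k.
rewrite -exprM mulnC uv co addn1 exprS exprM exprVn mulfK //.
by rewrite !expf_neq0.
Qed.

Section Algebra.
Variables (a c : J -> K) (S : algType K) (X Y : J -> S).
Hypotheses (a0 : forall k, a k != 0) (c0 : forall k, c k != 0).
Hypothesis XY : symp_rel p rho a c X Y.
Hypothesis S_gen : forall s, generated (merge_pair X Y) s.

Lemma symp_basis : is_basis (mono (p := p) (merge_pair X Y)).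
Proof.
split; first exact: (symp_independent p_pr rho_prim a0 c0 XY).
exact: (mono_spanning p_pr ((symp_rel_torus p_pr rho_prim _ _ _ _).1 XY) S_gen).
Qed.

Lemma symp_degree : has_degree S (p ^ #|J|).
Proof.
by apply: (basis_rV symp_basis); rewrite card_symp_exp // mulnn.
Qed.

Lemma symp_morphism (B : algType K) (X' Y' : J -> B) : symp_rel p rho a c X' Y' ->
  exists f : {lrmorphism S -> B}, forall k, f (merge_pair X Y k) = merge_pair X' Y' k.
Proof.
move=> XY'; have toT := symp_rel_torus p_pr rho_prim.
exact: (torus_universal p_pr ((toT _ _ _ _ _ _).1 XY) ((toT _ _ _ _ _ _).1 XY') S_gen symp_basis).
Qed.

(** The monomials form a basis on both sides. *)
Lemma split_isomorphism : split_by p rho a c ->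
  exists (d : nat) (f : {lrmorphism S -> 'M[K]_d.+1}), bijective f.
Proof.
case=> d [X' [Y' [dJ XY']]]; have [f fE] := symp_morphism XY'; exists d, f.
have fm v : f (mono (merge_pair X Y) v) = mono (p := p) (merge_pair X' Y') v.
  by rewrite /mono rmorph_prod; apply: eq_bigr => k _; rewrite rmorphXn /= fE.
have bas : is_basis (mono (p := p) (merge_pair X' Y')).
  split; first exact: (symp_independent p_pr rho_prim a0 c0 XY').
  exact: (symp_spanning_mx p_pr rho_prim a0 c0 XY').
have [g gE] := basis_linear_ex (mono (merge_pair X Y)) bas.
exists g => [v|v].
  by apply: (eq_linear_spanning (h := g \o f) (h' := idfun) symp_basis.2) => u /=; rewrite fm.
by apply: (eq_linear_spanning (h := f \o g) (h' := idfun) bas.2) => u /=; rewrite gE.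
Qed.

End Algebra.
End SplitCalculus.

(** * Splitting in the Brauer group *)

Lemma brauer_equivalent_matrix (K : fieldType) (A : algType K) (d : nat)
    (f : {lrmorphism A -> 'M[K]_d.+1}) : bijective f -> brauer_equivalent A K^o.
Proof.
case=> g fK gK; pose h (X : 'M[A]_1) : 'M[K^o]_d.+1 := f (X 0 0).
have hB : GRing.zmod_morphism h by move=> X Y; rewrite /h !mxE rmorphB.
have hM : GRing.monoid_morphism h.
  split=> [|X Y]; first by rewrite /h mxE eqxx rmorph1.
  by rewrite /h mxE big_ord1 rmorphM.
pose m1 := GRing.isZmodMorphism.Build _ _ h hB.
pose m2 := GRing.isMonoidMorphism.Build _ _ h hM.
exists 0%N, d, (HB.pack h m1 m2 : {rmorphism 'M[A]_1 -> 'M[K^o]_d.+1}); split=> /=.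
  exists (fun X : 'M[K^o]_d.+1 => (g X)%:M) => [X|X].
    by rewrite /h /= fK [RHS]mx11_scalar.
  by rewrite /h mxE mulr1n gK.
move=> c; rewrite /h mxE mulr1n linearZ /= rmorph1.
by rewrite scalemx1 -[c%:A]/(c * 1) mulr1.
Qed.

Lemma brauer_power_trivial1 (K : fieldType) (S : algType K) (d : nat)
    (f : {lrmorphism S -> 'M[K]_d.+1}) : bijective f -> brauer_power_trivial S 1.
Proof.
move=> fbij; exists S, (fun u => u ord0); split; last exact: brauer_equivalent_matrix fbij.
have full (u v : 'I_1 -> S) : @dfwith _ (fun=> S) u ord0 (v ord0) = v.
  apply: functional_extensionality_dep => i; rewrite (ord1 i).
  exact: dfwith_in.
split=> // [u i a v w|V g gl].
  by rewrite (ord1 i) !dfwith_in.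
split.
  have [h hE] := multilinear_dfwith (fun=> 0) ord0 gl.
  by exists h => u; rewrite hE full.
by move=> h h' hg hg' v; rewrite (hg (fun=> v)) (hg' (fun=> v)).
Qed.

Section MatrixUnit.
Variables (R : nzRingType) (r : nat).
Implicit Types (u : R) (Y : 'M[R]_r.+1).
Let e : 'M[R]_r.+1 := delta_mx 0 0.

Lemma scalar_delta_comm u : e * u%:M = u%:M * e.
Proof.
apply/matrixP => i j; rewrite !mxE (bigD1 j) //= [in RHS](bigD1 i) //=.
rewrite !big1 => [|k ki|k kj]; last 2 first.
- by rewrite !mxE eq_sym (negPf ki) mul0r.
- by rewrite !mxE (negPf kj) mulr0.
by rewrite !mxE !eqxx !addr0 !mulr1n mulr_natl mulr_natr.
Qed.

Lemma corner_delta Y : e * Y * e = (Y 0 0)%:M * e.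
Proof.
have eY i k : (e * Y) i k = (i == 0)%:R * Y 0 k.
  rewrite mxE (bigD1 0) //= big1 ?addr0 => [|l l0]; first by rewrite mxE eqxx andbT.
  by rewrite mxE (negPf l0) andbF mul0r.
apply/matrixP => i j; rewrite !mxE (bigD1 0) //= [in RHS](bigD1 i) //=.
rewrite !big1 => [|k ki|k k0]; last 2 first.
- by rewrite !mxE eq_sym (negPf ki) mul0r.
- by rewrite !mxE (negPf k0) mulr0.
rewrite eY !mxE !eqxx !addr0 mulr1n /=.
by case: (i == 0); case: (j == 0); rewrite ?mul1r ?mul0r ?mulr1 ?mulr0.
Qed.

End MatrixUnit.

(** If matrices over T form a matrix algebra over K, then a diagonal matrix
    unit is an idempotent whose corner is both T and a matrix algebra. *)
Lemma brauer_trivial_corner (K : fieldType) (T : algType K) :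
  brauer_equivalent T K^o ->
  exists (d : nat) (theta : {lrmorphism T -> 'M[K]_d.+1}),
    forall X, exists u, theta u = X.
Proof.
case=> r [s [f [fbij fK]]]; have [g fgK gfK] := fbij.
pose F (u : T) : 'M[K]_s.+1 := f u%:M.
pose dl : 'M[T]_r.+1 := delta_mx 0 0; pose eps : 'M[K]_s.+1 := f dl.
have FM u v : F (u * v) = F u * F v by rewrite /F scalar_mxM; apply: rmorphM.
have F1 : F 1 = 1 by apply: rmorph1.
have FL (c : K) u v : F (c *: u + v) = c *: F u + F v.
  rewrite {1}/F raddfD rmorphD /=; congr (_ + _).
  rewrite -{1}[u]mul1r scalerAl scalar_mxM; transitivity (f (c%:A)%:M * f u%:M).
    exact: rmorphM.
  rewrite fK -[(c%:A)%:M]/((c * 1)%:M) mulr1.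
  exact: mul_scalar_mx.
have epsF u : eps * F u = F u * eps.
  transitivity (f (dl * u%:M)); first by symmetry; apply: rmorphM.
  by rewrite scalar_delta_comm; apply: rmorphM.
have epsI : eps * eps = eps.
  transitivity (f (dl * dl)); first by symmetry; apply: rmorphM.
  by congr (f _); apply: mul_delta_mx.
have eps0 : eps != 0.
  apply: contra_neq (oner_neq0 T) => e0; have : dl = 0.
    by apply: (can_inj fgK); rewrite -/eps e0; symmetry; apply: rmorph0.
  by move/matrixP/(_ 0 0); rewrite !mxE.
have [d [Q [Qf QE]]] : exists d (Q : 'M[K]_(d.+1, s.+1)), row_free Q /\ (Q :=: eps)%MS.
  have := row_base_free eps; have := eq_row_base eps; move: (row_base eps).
  rewrite -mxrank_eq0 in eps0; case: (\rank eps) eps0 => // d _ Q QE Qf.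
  by exists d, Q.
have Qeps : Q *m eps = Q.
  have /submxP[D ->] : (Q <= eps)%MS by rewrite QE.
  by rewrite -mulmxA -[eps *m eps]/(eps * eps) epsI.
have QF u : (Q *m F u <= Q)%MS.
  by rewrite -{1}Qeps -mulmxA -[eps *m _]/(eps * F u) epsF mulmxA QE submxMl.
have [th thP] := choice (fun u => restricts_ex (QF u)).
have [|||theta thE] := @lrmorphism_of_fun K T 'M[K]_d.+1 th.
- move=> c u v; apply: (restricts_inj Qf (thP _)); rewrite FL.
  by apply: restrictsD; [apply: restrictsZ|].
- by apply: (restricts_inj Qf (thP _)); rewrite F1; apply: restricts1.
- by move=> u v; apply: (restricts_inj Qf (thP _)); rewrite FM; apply: restrictsM.
have [P QP] : exists P, Q *m P = 1%:M by exists (pinvmx Q); apply: mulmxVp.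
exists d, theta => X; pose A : 'M[K]_s.+1 := eps *m P *m X *m Q.
pose u := (g A) 0 0; exists u; rewrite thE; apply: (restricts_inj Qf (thP u)).
have Fu : F u * eps = A.
  transitivity (f (u%:M * dl)); first by symmetry; apply: rmorphM.
  rewrite -corner_delta; transitivity (f dl * f (g A) * f dl).
    by transitivity (f (dl * g A) * f dl); [apply: rmorphM | congr (_ * _); apply: rmorphM].
  rewrite gfK -/eps -[eps * A * eps]/(eps *m A *m eps) /A -!mulmxA Qeps !mulmxA.
  by rewrite -[eps *m eps]/(eps * eps) epsI.
rewrite /restricts -{2}Qeps -mulmxA -[eps *m _]/(eps * F u) epsF Fu /A !mulmxA Qeps.
by rewrite QP mul1mx.
Qed.

Lemma card_dffun_const (I B : finType) :
  #|{dffun forall _ : I, B}| = (#|B| ^ #|I|)%N.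
Proof. exact: card_ffun. Qed.

Section TrivialPowers.
Variables (p : nat) (K : fieldType) (rho : K).
Hypotheses (p_pr : prime p) (rho_prim : p.-primitive_root rho).
Variables (J : finType) (a c : J -> K) (S : algType K) (X Y : J -> S).
Hypotheses (a0 : forall k, a k != 0) (c0 : forall k, c k != 0).
Hypothesis XY : symp_rel p rho a c X Y.
Hypothesis S_gen : forall s, generated (merge_pair X Y) s.

Let S_basis := symp_basis p_pr rho_prim a0 c0 XY S_gen.

(** If the tensor power is split, it acts on matrices of the least possible
    size; its factors give e.+1 commuting symplectic families with the same
    powers, to be folded into one. *)
Lemma split_of_trivial_power e :
  brauer_power_trivial S e.+1 -> split_by p rho a (fun k => c k ^+ e.+1).
Proof.
case=> T [t [tens /brauer_trivial_corner [d [theta theta_surj]]]].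
have span := tensor_spanning (fun _ => S_basis) tens.
have dp : (d.+1 <= p ^ (#|J| * e.+1))%N.
  have sp : spanning (fun beta : {dffun forall o : 'I_e.+1, {ffun J * bool -> 'F_p}} =>
      theta (t (fun o => mono (merge_pair X Y) (beta o)))).
    move=> A; have [u <-] := theta_surj A; have [g ->] := span u; exists g.
    by rewrite linear_sum; apply: eq_bigr => beta _; rewrite linearZ.
  have := spanning_card_mx sp; rewrite card_dffun_const card_symp_exp // card_ord.
  by rewrite -expnD addnn -muln2 -!expnM mulnAC expnM mulnn leq_sqr.
have [iota [iota_comm _]] := tensor_inclusions tens.
pose emb (o : option 'I_e) : 'I_e.+1 := if o is Some i then lift ord0 i else ord0.
have emb_inj : injective emb.
  by move=> [i|] [j|] //= /lift_inj->.
have [Xp Yp XX YY YX] := XY.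
pose X1 (k : option 'I_e * J) := theta (iota (emb k.1) (X k.2)).
pose Y1 (k : option 'I_e * J) := theta (iota (emb k.1) (Y k.2)).
have pow (o : 'I_e.+1) (u : S) (b : K) : u ^+ p = b%:A -> theta (iota o u) ^+ p = b%:A.
  by move=> up; rewrite -!rmorphXn /= up !linearZ /= !rmorph1.
have comm (o o' : 'I_e.+1) (u v : S) : o != o' ->
    theta (iota o u) * theta (iota o' v) = theta (iota o' v) * theta (iota o u).
  by move=> oo'; rewrite -!rmorphM /= iota_comm.
have XY1 : symp_rel p rho (fun k => a k.2) (fun k => c k.2) X1 Y1.
  split=> [k|k|[o k] [o' l]|[o k] [o' l]|[o k] [o' l]].
  - exact: pow.
  - exact: pow.
  - case: (eqVneq o o') => [->|oo']; last by apply: comm; rewrite (inj_eq emb_inj).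
    by rewrite /X1 -!rmorphM /= XX.
  - case: (eqVneq o o') => [->|oo']; last by apply: comm; rewrite (inj_eq emb_inj).
    by rewrite /Y1 -!rmorphM /= YY.
  rewrite xpair_eqE; case: (eqVneq o o') => [->|oo'] /=.
    by rewrite /X1 /Y1 -!rmorphM /= YX !linearZ.
  by rewrite scale1r; apply: comm; rewrite (inj_eq emb_inj).
have := split_fold p_pr rho_prim a0 (fun k => c0 k.2) XY1.
rewrite card_ord => /(_ dp); congr split_by; apply: functional_extensionality_dep => k /=.
by rewrite prodr_const card_option card_ord.
Qed.

End TrivialPowers.

(** * The standard representation *)

Section Standard.
Variables (p : nat) (K : fieldType) (rho : K).
Hypotheses (p_pr : prime p) (rho_prim : p.-primitive_root rho).

Section MonomialMatrices.
Variables (I : finType) (N : nat) (h : 'I_N.+1 -> I) (h' : I -> 'I_N.+1).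
Hypotheses (hK : cancel h h') (h'K : cancel h' h).

(** The matrix of the operator that sends the basis vector v to c v times the
    basis vector s v. *)
Definition monomial_mx (c : I -> K) (s : I -> I) : 'M[K]_N.+1 :=
  \matrix_(i, j) (if h j == s (h i) then c (h i) else 0).

Lemma monomial_mxM c s c' s' :
  monomial_mx c s * monomial_mx c' s' =
  monomial_mx (fun v => c v * c' (s v)) (fun v => s' (s v)).
Proof.
apply/matrixP => i j; rewrite !mxE (bigD1 (h' (s (h i)))) //= !mxE h'K eqxx.
rewrite big1 ?addr0 => [|l li]; first by case: ifP => _; rewrite ?mulr0.
rewrite !mxE ifN ?mul0r //; apply: contraNneq li => <-.
by rewrite hK.
Qed.

Lemma monomial_mx_scalar (b : K) : monomial_mx (fun=> b) id = b%:A.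
Proof.
apply/matrixP => i j; rewrite !mxE (inj_eq (can_inj hK)) eq_sym.
by case: (i == j); rewrite ?mulr1 ?mulr0.
Qed.

Lemma monomial_mxZ (b : K) c s : b *: monomial_mx c s = monomial_mx (fun v => b * c v) s.
Proof. by apply/matrixP => i j; rewrite !mxE; case: ifP => _; rewrite ?mulr0. Qed.

Lemma eq_monomial_mx c s c' s' : c =1 c' -> s =1 s' -> monomial_mx c s = monomial_mx c' s'.
Proof. by move=> cc' ss'; apply/matrixP => i j; rewrite !mxE cc' ss'. Qed.

End MonomialMatrices.

(** On the functions on (Z/p)^J, the shift of each coordinate, twisted by c
    where it wraps around, and the multiplication by rho to the power of minus
    that coordinate form a symplectic family. *)
Lemma standard_split (J : finType) (c : J -> K) : split_by p rho c (fun=> 1).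
Proof.
pose I := {ffun J -> 'F_p}.
have [N NE] : exists N, #|I| = N.+1.
  by exists #|I|.-1; rewrite prednK //; apply/card_gt0P; exists 0.
pose h (i : 'I_N.+1) : I := enum_val (cast_ord (esym NE) i).
pose h' (v : I) : 'I_N.+1 := cast_ord NE (enum_rank v).
have hK : cancel h h' by move=> i; rewrite /h /h' enum_valK cast_ordKV.
have h'K : cancel h' h by move=> v; rewrite /h /h' cast_ordK enum_rankK.
pose w l (v : I) : K := c l ^+ ((v l).+1 %/ p).
pose X l := monomial_mx h (w l) (fun v => v + unit_exp l).
pose Y l := monomial_mx h (fun v => rexp rho (- v l)) id.
exists N, X, Y; split; first by rewrite -NE card_ffun card_Fp.
have mM := monomial_mxM hK h'K.
have unitE (l k : J) : unit_exp l k = (k == l)%:R :> 'F_p by rewrite ffunE.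
split=> [l|l|k l|k l|k l].
- have Xn n : X l ^+ n = monomial_mx h (fun v => c l ^+ ((v l + n) %/ p)) (fun v => v + unit_exp l *+ n).
    elim: n => [|n IH].
      rewrite expr0 -(scale1r 1) -(monomial_mx_scalar hK); apply: eq_monomial_mx => v.
        by rewrite addn0 divn_small ?ltn_Fp.
      by rewrite mulr0n addr0.
    rewrite exprSr IH mM; apply: eq_monomial_mx => v; last by rewrite mulrSr addrA.
    rewrite /w -exprD !ffunE; congr (_ ^+ _).
    rewrite ffunMnE unitE eqxx mulr1n val_Fp_add // val_Fp_nat // modnDmr.
    by rewrite addnS [in RHS](divn_eq (v l + n) p) -addnS divnMDl ?prime_gt0.
  rewrite Xn -(monomial_mx_scalar hK); apply: eq_monomial_mx => v.
    by rewrite divnDr // divn_small ?ltn_Fp // divnn prime_gt0.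
  apply/ffunP => k; rewrite !ffunE ffunMnE unitE.
  suff -> : (k == l)%:R *+ p = 0 :> 'F_p by rewrite addr0.
  by rewrite -mulr_natr (pchar_Fp_0 p_pr) mulr0.
- have Yn n : Y l ^+ n = monomial_mx h (fun v => rexp rho (- v l) ^+ n) id.
    elim: n => [|n IH].
      rewrite expr0 -(scale1r 1) -(monomial_mx_scalar hK); apply: eq_monomial_mx => v //.
    rewrite exprSr IH mM; apply: eq_monomial_mx => v //.
    by rewrite exprSr.
  rewrite Yn -(monomial_mx_scalar hK); apply: eq_monomial_mx => v //.
  by rewrite rexp_p.
- case: (eqVneq k l) => [->|kl] //; rewrite /X !mM; apply: eq_monomial_mx => v.
    by rewrite /w !ffunE [l == k]eq_sym (negPf kl) !addr0 mulrC.
  by rewrite addrAC.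
- by rewrite /Y !mM; apply: eq_monomial_mx => v //; rewrite mulrC.
rewrite /X /Y !mM monomial_mxZ; apply: eq_monomial_mx => v //=.
have rr : rexp rho (-1 : 'F_p) * rho = 1.
  by rewrite -{2}(rexp1 p rho) -rexpD // addNr rexp0.
rewrite !ffunE opprD rexpD // mulrC; case: (k == l); last first.
  by rewrite oppr0 rexp0 mulr1 mul1r.
by rewrite [RHS]mulrC -!mulrA [X in _ * (_ * X)]rr mulr1.
Qed.

End Standard.

(** * The exponent *)

Section Copies.
Variables (p : nat) (K : fieldType) (rho : K).
Hypotheses (p_pr : prime p) (rho_prim : p.-primitive_root rho).
Variables (J : finType) (a b : J -> K).
Hypothesis b0 : forall k, b k != 0.

(** With one family x_t, y_t for each t in a p-element set, the quotients of the x_t by x_0 have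
    p-th power 1, and the product of the y_t has a p-th power in K^p: in a
    representation where these act diagonally, the shifts are x_0 and the
    inverses of the other y_t. *)
Lemma split_copies :
  split_by p rho (fun k : 'I_p * J => a k.2) (fun k : 'I_p * J => b k.2).
Proof.
pose t0 : 'I_p := Ordinal (prime_gt0 p_pr).
pose c (k : 'I_p * J) := if k.1 == t0 then a k.2 else (b k.2)^-1.
have [d [S [D [dJ [Sp Dp SS DD DS]]]]] := standard_split p_pr rho_prim c.
have rho0 : rho != 0 by rewrite -(rexp1 p rho) rexp_neq0.
have SD k l : S k * D l = (if k == l then rho^-1 else 1) *: (D l * S k).
  rewrite DS [l == k]eq_sym; case: (k == l); last by rewrite !scale1r.
  by rewrite scalerA mulVf // scale1r.
have DS1 k l : k != l -> D k * S l = S l * D k by move=> kl; rewrite DS (negPf kl) scale1r.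
pose E k := if k.1 == t0 then 1 else D k.
pose x k := E k * S (t0, k.2).
pose P (k2 : J) := \prod_(t : 'I_p) (if t == t0 then 1 else S (t, k2)).
pose z k := if k.1 == t0 then D k * P k.2 else S k ^+ p.-1.
have ES k l2 : E k * S (t0, l2) = S (t0, l2) * E k.
  rewrite /E; case: eqP => [_|/eqP kt]; first by rewrite mul1r mulr1.
  by apply: DS1; apply: contraNneq kt => ->.
have Sx k l : k.1 != t0 -> S k * x l = (if k == l then rho^-1 else 1) *: (x l * S k).
  move=> kt; rewrite -[if _ then _ else _]mulr1; apply: scommMr; last by rewrite SS scale1r.
  rewrite /E; case: eqP => [lt|_]; last exact: SD.
  by rewrite ifN ?mul1r ?mulr1 ?scale1r //; apply: contraNneq kt => ->; apply/eqP.
have SDt k l : k.1 != t0 -> l.1 == t0 -> S k * D l = D l * S k.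
  by move=> kt lt; rewrite DS1 //; apply: contraNneq kt => <-.
have PS l2 k : P l2 * S k = S k * P l2.
  apply: commr_sym; apply: commr_prod => t _; case: (t == t0); first exact: commr1.
  exact: SS.
have PD l2 k : k.1 == t0 -> P l2 * D k = D k * P l2.
  move=> kt; apply: commr_sym; apply: commr_prod => t _.
  by case: eqP => [_|/eqP tt]; [apply: commr1 | rewrite /GRing.comm SDt].
have zz k l : z k * z l = z l * z k.
  rewrite /z; case: (boolP (k.1 == t0)) => kt; case: (boolP (l.1 == t0)) => lt.
  - apply: commrM; apply: commr_sym; apply: commrM.
    + exact: DD.
    + by apply: commr_sym; apply: PD.
    + exact: PD.
    + by apply: commr_prod => t _; case: (t == t0); [apply: commr1 | apply: PS].
  - apply: commrX; apply: commr_sym; apply: commrM; last by apply: commr_sym; apply: PS.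
    exact: SDt.
  - apply: commr_sym; apply: commrX; apply: commr_sym; apply: commrM; last by apply: commr_sym; apply: PS.
    exact: SDt.
  by apply/commrX/commr_sym/commrX; apply: SS.
have bp k2 : b k2 ^+ p * (b k2)^-1 ^+ p.-1 = b k2.
  rewrite -{1}[p]prednK ?prime_gt0 // exprS -mulrA -exprMn mulfV //.
  by rewrite expr1n mulr1.
have zp k : (b k.2 *: z k) ^+ p = (b k.2)%:A.
  rewrite exprZn /z; case: (boolP (k.1 == t0)) => kt; last first.
    rewrite exprAC Sp /c (negPf kt) exprZn expr1n scalerA bp //.
  rewrite exprMn_comm; last by apply: commr_sym; apply: PD.
  rewrite Dp scale1r mul1r /P prod_expr_commute => [|t u]; last first.
    case: (t == t0); case: (u == t0); rewrite ?mul1r ?mulr1 //; exact: SS.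
  rewrite (eq_bigr (fun t => (if t == t0 then 1 else (b k.2)^-1)%:A)) => [|t _].
    rewrite prod_in_alg (bigD1 t0) //= mul1r (eq_bigr (fun=> (b k.2)^-1)) => [|t /negPf-> //].
    by rewrite prodr_const cardC1 card_ord scalerA bp.
  case: (boolP (t == t0)) => tt; first by rewrite expr1n scale1r.
  by rewrite Sp /c (negPf tt).
exists d, x, (fun k => b k.2 *: z k); split=> //; split=> [k|k|k l|k l|k l].
- rewrite exprMn_comm; last exact: ES.
  rewrite Sp /c eqxx /E; case: (k.1 == t0); first by rewrite expr1n mul1r.
  by rewrite Dp scale1r mul1r.
- exact: zp.
- have EE : E k * E l = E l * E k.
    by rewrite /E; case: (k.1 == t0); case: (l.1 == t0); rewrite ?mul1r ?mulr1 //; apply: DD.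
  apply: commrM; apply: commr_sym; apply: commrM.
  + exact: esym EE.
  + exact: ES.
  + by apply: commr_sym; apply: ES.
  + exact: SS.
- rewrite -[RHS]scale1r; apply: scommZ; rewrite scale1r; exact: zz.
rewrite -[x l]scale1r; apply: scommZ; rewrite /z.
case: (boolP (k.1 == t0)) => kt; last first.
  rewrite (scomm_exprl _ (Sx k l kt)); congr (_ *: _).
  case: (k == l); last by rewrite expr1n.
  rewrite exprVn; apply: (mulfI (expf_neq0 p.-1 rho0)).
  by rewrite mulfV ?expf_neq0 // -exprSr prednK ?prime_gt0 // prim_expr_order.
have Dx : D k * x l = (if k.2 == l.2 then rho else 1) *: (x l * D k).
  rewrite -[if _ then _ else _]mul1r; apply: scommMr.
    by rewrite /E scale1r; case: (l.1 == t0); rewrite ?mul1r ?mulr1 //; apply: DD.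
  by rewrite DS; congr (_ *: _); rewrite [k]surjective_pairing (eqP kt) xpair_eqE eqxx.
have Px : P k.2 * x l =
    \prod_(t : 'I_p) (if (t != t0) && ((t, k.2) == l) then rho^-1 else 1) *: (x l * P k.2).
  apply: scomm_prodl => t; case: (boolP (t == t0)) => tt /=.
    by rewrite mul1r mulr1 scale1r.
  exact: (Sx (t, k.2)).
rewrite (scommMl Dx Px); congr (_ *: _).
case: (boolP (l.1 == t0)) => lt.
  rewrite big1 ?mulr1 => [|t _]; last first.
    by case: andP => // -[tt /eqP tl]; move: lt; rewrite -tl (negPf tt).
  by rewrite [k in RHS]surjective_pairing [l in RHS]surjective_pairing xpair_eqE (eqP kt) (eqP lt) eqxx.
rewrite [RHS]ifN; last by apply: contraNneq lt => <-.
have pairE t : ((t, k.2) == l) = (t == l.1) && (k.2 == l.2) by case: (l) => u v.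
rewrite (bigD1 l.1) //= big1 ?mulr1 => [|t tl]; last by rewrite pairE (negPf tl) andbF.
rewrite lt /= pairE eqxx /=.
by case: (k.2 == l.2); rewrite ?mulr1 // mulfV.
Qed.

End Copies.

Lemma generated_image (F : fieldType) (A B : algType F) (I : Type) (z : I -> A)
    (f : {lrmorphism A -> B}) a : generated z a -> generated (fun i => f (z i)) (f a).
Proof.
elim=> [i|| c u v _ IHu _ IHv | u v _ IHu _ IHv].
- exact: (generated_gen (fun i => f (z i))).
- by rewrite rmorph1; apply: generated_one.
- by rewrite linearP; apply: generated_lin.
by rewrite rmorphM; apply: generated_mul.
Qed.

Section Exponent.
Variables (p : nat) (K : fieldType) (rho : K).
Hypotheses (p_pr : prime p) (rho_prim : p.-primitive_root rho).
Variables (J : finType) (a c : J -> K) (S : algType K) (X Y : J -> S).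
Hypotheses (a0 : forall k, a k != 0) (c0 : forall k, c k != 0).
Hypothesis XY : symp_rel p rho a c X Y.
Hypothesis S_gen : forall s, generated (merge_pair X Y) s.

Let S_basis := symp_basis p_pr rho_prim a0 c0 XY S_gen.

(** The p commuting images of S in a matrix algebra of the dimension of the
    tensor power exhibit that algebra as the tensor power. *)
Lemma brauer_power_trivial_p : brauer_power_trivial S p.
Proof.
have [d [X1 [Y1 [dJ XY1]]]] := split_copies p_pr rho_prim a c0.
pose w := merge_pair X1 Y1; have [Xp Yp XX YY YX] := XY1.
have aJ0 (k : 'I_p * J) : a k.2 != 0 by [].
have cJ0 (k : 'I_p * J) : c k.2 != 0 by [].
have wP := (symp_rel_torus p_pr rho_prim _ _ _ _).1 XY1.
pose idx (t : 'I_p) (k : J * bool) : ('I_p * J) * bool := ((t, k.1), k.2).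
have XYt t : symp_rel p rho a c (fun k => X1 (t, k)) (fun k => Y1 (t, k)).
  split=> [k|k|k l|k l|k l]; [exact: Xp | exact: Yp | exact: XX | exact: YY |].
  by rewrite YX xpair_eqE eqxx.
have phi_ex t := symp_morphism p_pr rho_prim a0 c0 XY S_gen (XYt t).
pose phi t := projT1 (cid (phi_ex t)).
have phiE t k : phi t (merge_pair X Y k) = w (idx t k).
  by rewrite /phi; case: cid => f /= ->; case: k => k [].
have phi_comm t u s s' : t != u -> phi t s * phi u s' = phi u s' * phi t s.
  move=> tu; apply: generated_comm (generated_image (phi t) (S_gen s))
    (generated_image (phi u) (S_gen s')) => k l.
  rewrite !phiE wP.2 /symp_coef /= xpair_eqE (negPf tu) scale1r; done.
have w_basis : is_basis (mono (p := p) w).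
  split; first exact: (symp_independent p_pr rho_prim aJ0 cJ0 XY1).
  exact: (symp_spanning_mx p_pr rho_prim aJ0 cJ0 XY1).
have w0 : forall k, merge_pair (fun k : 'I_p * J => a k.2) (fun k => c k.2) k != 0.
  exact: merge_pair_neq0.
have q0 (k l : ('I_p * J) * bool) := symp_coef_neq0 p_pr rho_prim k l.
exists 'M[K]_d.+1, (prod_morph phi); split; last first.
  by apply: (brauer_equivalent_matrix (f := idfun)); exists id.
apply: (prod_morph_tensor phi_comm (b := fun _ => mono (merge_pair X Y))).
  by move=> o; exact: S_basis.2.
have idx_inj t : injective (idx t).
  move=> [k s] [l s'] /eqP; rewrite /idx !xpair_eqE eqxx /=.
  by case/andP=> /eqP-> /eqP->.
have idx_neq t u k l : t != u -> idx t k != idx u l.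
  by move=> tu; rewrite /idx !xpair_eqE (negPf tu).
have idx_surj i : exists t k, i = idx t k by case: i => [[t k] s]; exists t, (k, s).
apply: (joint_basis p_pr w0 q0 wP w_basis idx_inj idx_neq idx_surj
  (b := fun t v => phi t (mono (merge_pair X Y) v))).
move=> t v; have -> : phi t (mono (merge_pair X Y) v) = mono (fun k => w (idx t k)) v.
  by rewrite /mono rmorph_prod; apply: eq_bigr => k _; rewrite rmorphXn /= phiE.
exact: (subfamily_line p_pr w0 q0 wP (fun=> erefl)).
Qed.

(** If a power e < p were trivial, the cyclic algebras (a, c ^ e) would have a
    split tensor product, hence so would the (a, c), and S itself would be
    split. *)
Lemma symp_exponent : has_exponent S p \/ has_exponent S 1.
Proof.
case: (pselect (brauer_power_trivial S 1)) => [tr1|ntr1].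
  by right; split=> // -[|[]].
left; split; [exact: prime_gt0 | exact: brauer_power_trivial_p |].
move=> [//|e] ep tre; apply: ntr1.
have := split_of_trivial_power p_pr rho_prim a0 c0 XY S_gen tre.
move/(split_coprime p_pr rho_prim a0 c0 ep) => sp.
have [d [f fbij]] := split_isomorphism p_pr rho_prim a0 c0 XY S_gen sp.
exact: brauer_power_trivial1 fbij.
Qed.

End Exponent.

(** * Simple images of the Clifford algebra *)

Lemma prime_primitive_root (K : fieldType) (p : nat) (r : K) :
  prime p -> r ^+ p = 1 -> r != 1 -> p.-primitive_root r.
Proof.
move=> p_pr rp r1; have [k kr kp] := prim_order_exists (prime_gt0 p_pr) rp.
case: (primeP p_pr) => _ /(_ k kp) /orP[/eqP k1|/eqP <- //].
by move: r1; rewrite -[r]expr1 -k1 (prim_expr_order kr) eqxx.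
Qed.

Section SimpleImages.
Variables (p : nat) (F : fieldType) (rho : F) (n m : nat) (hm : (m.*2 <= n)%N).
Variables (C : algType F) (y : 'I_n -> C) (beta : 'I_n -> F).
Hypotheses (p_pr : prime p) (rho_prim : p.-primitive_root rho).
Hypothesis beta_neq0 : forall i, beta i != 0.
Hypothesis yP : torus_rel p beta (fun i j => rexp rho (block_H 'F_p n m i j)) y.
Hypothesis y_gen : forall c, generated y c.

Variables (K : fieldType) (S : algType K) (g : {rmorphism C -> S}).
Hypothesis g_surj : forall s, exists c, g c = s.
Hypothesis S_center : forall z : S, (forall u, z * u = u * z) -> exists c : K, z = c%:A.

Let central_image (z : C) : (forall u, z * u = u * z) -> exists c : K, g z = c%:A.
Proof.
move=> zC; apply: S_center => s; have [u <-] := g_surj s.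
by rewrite -!rmorphM zC.
Qed.

(** The center of S contains an image of F, with a root of unity that is still
    primitive; over it, the images of the two generators of each noncommutative
    factor form a symplectic family that generates S, as the other generators
    are sent to scalars. *)
Lemma simple_image_degree_exponent :
  has_degree S (p ^ m) /\ (has_exponent S p \/ has_exponent S 1).
Proof.
have iota_ex (c : F) : exists k : K, g c%:A = k%:A.
  by apply: central_image => u; rewrite -scalerAl -scalerAr mul1r mulr1.
have [iota iotaE] := choice iota_ex.
have alg_inj : injective (fun k : K => k%:A : S).
  move=> k l /eqP; rewrite -subr_eq0 -scalerBl scaler_eq0 oner_eq0 orbF subr_eq0.
  by move/eqP.
have gZ c u : g (c *: u) = iota c *: g u.
  by rewrite -[c *: u]mulr_algl rmorphM iotaE mulr_algl.
have iota0 c : c != 0 -> iota c != 0.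
  move=> c0; have : g c%:A * g (c^-1)%:A = 1.
    by rewrite -rmorphM -scalerAl mul1r scalerA mulfV // scale1r rmorph1.
  by rewrite iotaE; apply: contra_eq_neq => ->; rewrite scale0r mul0r eq_sym oner_neq0.
have iota1 : iota 1 = 1 by apply: alg_inj; rewrite /= -iotaE !scale1r rmorph1.
have rho'_prim : p.-primitive_root (iota rho).
  apply: prime_primitive_root => //.
    apply: alg_inj; transitivity ((iota rho)%:A ^+ p : S).
      by rewrite exprZn expr1n.
    rewrite -iotaE -rmorphXn exprZn expr1n (prim_expr_order rho_prim).
    by rewrite iotaE iota1.
  apply/negP => /eqP r1; have : rho - 1 != 0.
    rewrite subr_eq0; apply/negP => /eqP r; have := eq_prim_root_expr rho_prim 0 1.
    by rewrite r expr0 expr1 eqxx !modn_small ?prime_gt1 ?prime_gt0.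
  move/iota0/negP; apply; apply/eqP/alg_inj; rewrite /= -iotaE scalerBl rmorphB !iotaE.
  by rewrite r1 iota1 subrr scale0r.
pose X (k : 'I_m) := g (y (even_idx hm k)); pose Y (k : 'I_m) := g (y (odd_idx hm k)).
pose a (k : 'I_m) := iota (beta (even_idx hm k)).
pose c (k : 'I_m) := iota (beta (odd_idx hm k)).
have gcomm (k l : 'I_m) (s t : bool) :
    g (y (head_idx hm (k, s))) * g (y (head_idx hm (l, t))) =
    (if k == l then iota (rexp rho (symp p s t)) else 1) *:
    (g (y (head_idx hm (l, t))) * g (y (head_idx hm (k, s)))).
  rewrite -!rmorphM yP.2 block_H_head gZ /=; case: (k == l) => //.
  by rewrite rexp0 iota1.
have XY : symp_rel p (iota rho) a c X Y.
  split=> [k|k|k l|k l|k l].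
  - by rewrite /X -rmorphXn yP.1 iotaE.
  - by rewrite /Y -rmorphXn yP.1 iotaE.
  - by rewrite [LHS](gcomm k l false false) rexp0 iota1 if_same scale1r.
  - by rewrite [LHS](gcomm k l true true) rexp0 iota1 if_same scale1r.
  by rewrite [LHS](gcomm k l true false) [symp _ _ _]/(1 : 'F_p) rexp1.
have S_gen s : generated (merge_pair X Y) s.
  have [u <-] := g_surj s.
  elim: (y_gen u) => [i|| b v w _ IHv _ IHw | v w _ IHv _ IHw].
  - case: (idx_cases hm i) => [[[k []] ->]|[j ->]].
    + exact: (generated_gen (merge_pair X Y) (k, true)).
    + exact: (generated_gen (merge_pair X Y) (k, false)).
    have [v|k ->] := @central_image (y (tail_idx j)); last first.
      by apply/generated_scale/generated_one.
    symmetry; apply: (@generated_comm _ _ _ 'I_1 y (fun=> y (tail_idx j))) (y_gen v) _.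
      by move=> k _; rewrite yP.2 block_H_tailr rexp0 scale1r.
    exact: (generated_gen _ ord0).
  - by rewrite rmorph1; apply: generated_one.
  - by rewrite rmorphD gZ; apply: generated_lin.
  by rewrite rmorphM; apply: generated_mul.
have a0 k : a k != 0 by apply: iota0.
have c0 k : c k != 0 by apply: iota0.
split; last by have := symp_exponent p_pr rho'_prim a0 c0 XY S_gen.
have := symp_degree p_pr rho'_prim a0 c0 XY S_gen.
by rewrite card_ord.
Qed.

End SimpleImages.

(** * The structure theorem *)

Theorem mainTheorem1 (p : nat) (F : fieldType) (rho : F) (n : nat)
    (alpha : 'I_n -> F) (M : 'M['F_p]_n) (C : algType F) (x : 'I_n -> C)
    (p_prime : prime p) (rho_prim : p.-primitive_root rho)
    (alpha_neq0 : forall k, alpha k != 0) (M_skew : skew_symmetric M)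
    (C_clifford : presents (clifford_rel p rho alpha M) x) :
  (exists (m : nat) (D : 'M['F_p]_n),
     [/\ (m.*2 <= n)%N, D \in unitmx & block_H 'F_p n m = D *m M *m D^T]) /\
  (forall (m : nat) (hm : (m.*2 <= n)%N) (D : 'M['F_p]_n),
     D \in unitmx -> block_H 'F_p n m = D *m M *m D^T ->
     let y := monomials p x D in
     let beta := monomial_power p alpha M D in
     [/\ p_central p rho y (block_H 'F_p n m) /\ (forall c : C, generated y c),
         is_tensor_product (@factor_mul n m hm F C y),
         forall k : 'I_m,
           presents
             (cyclic_rel p rho (beta (even_idx hm k)) (beta (odd_idx hm k)))
             (gen_elt (pair_family hm y k)),
         presents (commutative_rel p (fun j => beta (tail_idx j)))
             (gen_elt (tail_family (m := m) y)) /\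
         (forall u v : genalg (tail_family (m := m) y), u * v = v * u)
       & azumaya (over_center C) /\
         (forall (K : fieldType) (S : algType K) (g : {rmorphism C -> S}),
            (forall s : S, exists c : C, g c = s) -> simple_with_center S ->
            has_degree S (p ^ m) /\
            (has_exponent S p \/ has_exponent S 1))]).
Proof.
have normal := alternating_normal_form M_skew; split=> [//|m hm D D_unit HD y beta].
have beta_neq0 i : beta i != 0 by apply: monomial_power_neq0.
have yP := monomials_torus p_prime rho_prim C_clifford D.
rewrite -HD in yP.
have y_gen := monomials_generated p_prime rho_prim alpha_neq0 C_clifford D_unit.
have y_basis := monomials_basis p_prime rho_prim alpha_neq0 C_clifford D_unit.
have q_neq0 i j : rexp rho (block_H 'F_p n m i j) != 0 by apply: rexp_neq0.
split.
- split=> //; split=> [k|k||i j _].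
  + by have [z [zy yz]] := gen_unit p_prime yP beta_neq0 q_neq0 k; exists z.
  + by exists (beta k); apply: yP.1.
  + by rewrite HD; apply: skew_congruence.
  exact: yP.2.
- exact: (factor_tensor hm p_prime rho_prim beta_neq0 yP y_basis).
- exact: (pair_presents hm p_prime rho_prim beta_neq0 yP y_basis).
- split; first exact: (tail_presents p_prime rho_prim beta_neq0 yP y_basis).
  exact: (tail_commutative yP).
split; first exact: (clifford_azumaya hm p_prime rho_prim beta_neq0 yP y_gen y_basis).
move=> K S g g_surj [_ S_center].
exact: (simple_image_degree_exponent hm p_prime rho_prim beta_neq0 yP y_gen g_surj S_center).
Qed.
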